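(* Let $S_{n_1n_2n_3}^{n_1'n_2'n_3'}(v)$ be the weights defined in the context. Fix $v\in\mathbb{C}$ and $(n_1,n_2,n_3)\in\mathbb{Z}_{\ge0}^3$. Then $$\sum_{(n_1',n_2',n_3')\in\mathbb{Z}_{\ge0}^3}S_{n_1n_2n_3}^{n_1'n_2'n_3'}(v)=1 .$$ Furthermore, fix complex numbers $v$ and $w$, and nonnegative integers $n_1,\dots,n_6$ and $n_1'',\dots,n_6''$. Then $$\begin{aligned} &\sum_{\mathbf{n}'}S_{n_1n_2n_3}^{n_1'n_2'n_3'}(q^{2n_5}w)\,S_{n_1'n_4n_5}^{n_1''n_4'n_5'}(w)\,S_{n_3'n_5'n_6'}^{n_3''n_5''n_6''}(q^{-2n_2''}v)\,S_{n_2'n_4'n_6}^{n_2''n_4''n_6'}(v)\\ &\qquad=\sum_{\mathbf{n}'}S_{n_3n_5n_6}^{n_3'n_5'n_6'}(v)\,S_{n_2n_4n_6'}^{n_2'n_4'n_6''}(q^{-2n_3'}v)\,S_{n_1n_4'n_5'}^{n_1'n_4''n_5''}(q^{2n_3'}w)\,S_{n_1'n_2'n_3'}^{n_1''n_2''n_3''}(w), \end{aligned}$$ where both sums are over all $\mathbf{n}'=(n_1',n_2',n_3',n_4',n_5',n_6')\in\mathbb{Z}_{\ge0}^6$.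
   Context: Let $q\in\mathbb{C}$. For $a\in\mathbb{C}$ and $k\in\mathbb{Z}_{\ge0}$ let $(a;q^2)_k=\prod_{j=0}^{k-1}(1-q^{2j}a)$, and let ${}_2\varphi_1\big(\begin{smallmatrix}a_1,a_2\\ b_1\end{smallmatrix}\big|q^2,z\big)=\sum_{k\ge0}\frac{(a_1;q^2)_k(a_2;q^2)_k}{(q^2;q^2)_k(b_1;q^2)_k}z^k$. For $v\in\mathbb{C}$ and $n_1,n_2,n_3,n_1',n_2',n_3'\in\mathbb{Z}_{\ge0}$ define $$\begin{aligned} S_{n_1n_2n_3}^{n_1'n_2'n_3'}(v)=\ & q^{(n_1+n_3+n_1'+n_3'+2)n_2-2(n_1'+1)n_2'}\,\frac{(q^2;q^2)_{n_1}(q^{-2n_1'};q^2)_{n_2}(q^2;q^2)_{n_3}}{(q^2;q^2)_{n_1'}(q^2;q^2)_{n_2'}(q^2;q^2)_{n_3'}}\,v^{n_2'}\,\frac{(vq^{-2n_1'};q^2)_{n_3'}}{(v;q^2)_{n_3}}\\ &\times{}_2\varphi_1\Big(\begin{matrix}q^{-2n_2},\,q^{2n_1+2}\\ q^{2(n_1'-n_2+1)}\end{matrix}\Big|\,q^2,q^{-2n_3}\Big)\,\mathbf{1}_{n_1+n_2=n_1'+n_2'}\,\mathbf{1}_{n_2+n_3=n_2'+n_3'}. \end{aligned}$$ Here the product of $(q^{-2n_1'};q^2)_{n_2}$ with the series (which is of the form $0/0$ when $n_1'<n_2$) is understood after termwise cancellation, i.e. $$(q^{-2n_1'};q^2)_{n_2}\;{}_2\varphi_1(\cdots)=(q^2;q^2)_{n_2}\sum_{k=0}^{n_2}\frac{(q^{-2n_1'};q^2)_{n_2-k}(q^{2n_1+2};q^2)_k}{(q^2;q^2)_{n_2-k}(q^2;q^2)_k}\,q^{-2k(n_1'+n_3+1)}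 .$$ Parameters are assumed such that all denominators are nonzero (in particular $q\neq0$ and $q$ is not a root of unity). *)

(* Defs.v *)
From HB Require Import structures.
From mathcomp Require Export all_boot all_order all_algebra complex.
From mathcomp Require Export mathcomp_extra boolp classical_sets functions.
From mathcomp Require Export cardinality fsbigop reals.
From mathcomp Require Import zify ring.
Set Implicit Arguments.
Unset Strict Implicit.
Unset Printing Implicit Defensive.
Export Order.TTheory GRing.Theory Num.Theory.
Local Open Scope ring_scope.
Local Open Scope classical_set_scope.

(* (a; q^2)_k; the base is q^2 throughout. *)
Definition qpoch (F : fieldType) (q a : F) (k : nat) : F :=
  \prod_(j < k) (1 - q ^+ (2 * j) * a).

(* 2phi1(a1, a2; b1 | q^2, z) for a terminating series: the sum is a
   finite-support sum, equal to 0 by convention on infinite support. *)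
Definition phi21 (F : fieldType) (q a1 a2 b1 z : F) : F :=
  \sum_(k \in [set: nat])
    (qpoch q a1 k * qpoch q a2 k / (qpoch q (q ^+ 2) k * qpoch q b1 k) * z ^+ k).

(* (q^(-2 n1'); q^2)_n2 * 2phi1(q^(-2 n2), q^(2 n1 + 2); q^(2 (n1' - n2 + 1)) |
   q^2, q^(-2 n3)) after termwise cancellation, so that it makes sense also
   when n1' < n2; see qpoch_phi21E below for n2 <= n1'. *)
Definition qpoch_phi21 (F : fieldType) (q : F) (n1 n2 n3 n1' : nat) : F :=
  qpoch q (q ^+ 2) n2 *
  \sum_(k < n2.+1)
    (qpoch q (q ^- (2 * n1')) (n2 - k) * qpoch q (q ^+ (2 * n1 + 2)) k
     / (qpoch q (q ^+ 2) (n2 - k) * qpoch q (q ^+ 2) k)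
     * q ^- (2 * k * (n1' + n3 + 1))).

Definition conserved (n1 n2 n3 n1' n2' n3' : nat) : bool :=
  (n1 + n2 == n1' + n2')%N && (n2 + n3 == n2' + n3')%N.

(* Lower indices come first, then upper ones. *)
Definition Sweight (F : fieldType) (q v : F) (n1 n2 n3 n1' n2' n3' : nat) : F :=
  q ^ (((n1 + n3 + n1' + n3' + 2) * n2)%N%:Z - (2 * (n1' + 1) * n2')%N%:Z)
  * (qpoch q (q ^+ 2) n1 * qpoch q (q ^+ 2) n3
     / (qpoch q (q ^+ 2) n1' * qpoch q (q ^+ 2) n2' * qpoch q (q ^+ 2) n3'))
  * v ^+ n2'
  * (qpoch q (v * q ^- (2 * n1')) n3' / qpoch q v n3)
  * qpoch_phi21 q n1 n2 n3 n1'
  * (conserved n1 n2 n3 n1' n2' n3')%:R.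

Lemma qpochS (F : fieldType) (q a : F) k :
  qpoch q a k.+1 = qpoch q a k * (1 - q ^+ (2 * k) * a).
Proof. by rewrite /qpoch big_ord_recr. Qed.

Lemma qpoch0 (F : fieldType) (q a : F) : qpoch q a 0 = 1.
Proof. by rewrite /qpoch big_ord0. Qed.

Lemma qpoch_neq0 (F : fieldType) (q : F) m k :
  (forall i, (0 < i)%N -> q ^+ i != 1) ->
  (0 < m)%N -> qpoch q (q ^+ m) k != 0.
Proof.
move=> q1 m0; rewrite /qpoch; apply/prodf_neq0 => j _.
by rewrite subr_eq0 eq_sym -exprD q1//; lia.
Qed.

Lemma qpoch_expV_eq0 (F : fieldType) (q : F) m k : q != 0 ->
  (m < k)%N -> qpoch q (q ^- (2 * m)) k = 0.
Proof.
move=> q0 mk; rewrite /qpoch (bigD1 (Ordinal mk))//=.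
by rewrite mulfV ?expf_neq0// subrr mul0r.
Qed.

Lemma qpoch_phi21_term (F : fieldType) (q : F) m n k : q != 0 ->
  (forall i, (0 < i)%N -> q ^+ i != 1) -> (n <= m)%N -> (k <= n)%N ->
  qpoch q (q ^+ 2) n * qpoch q (q ^- (2 * m)) (n - k)
    * qpoch q (q ^+ (2 * (m - n + 1))) k =
  qpoch q (q ^- (2 * m)) n * qpoch q (q ^- (2 * n)) k
    * q ^+ (2 * k * (m + 1)) * qpoch q (q ^+ 2) (n - k).
Proof.
move=> q0 q1 nm; elim: k => [|k IH] kn.
  by rewrite subn0 !qpoch0 !mulr1 mulrC.
have nk : (n - k = (n - k.+1).+1)%N by lia.
have := IH (ltnW kn); rewrite nk !qpochS.
set d := (n - k.+1)%N in nk *.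
have -> : (m - n + 1 = m - n.-1)%N by lia.
set b := (m - n.-1)%N.
pose X := q ^+ (2 * d); pose Y := q ^+ (2 * (b + k)); pose Z := q ^+ (2 * k).
have qX : q ^+ (2 * m) = X * Y by rewrite /X /Y -exprD; congr (_ ^+ _); lia.
have qn : q ^+ (2 * n) = X * q ^+ 2 * Z.
  by rewrite /X /Z -!exprD; congr (_ ^+ _); lia.
have qb : q ^+ (2 * k) * q ^+ (2 * b) = Y.
  by rewrite /Y -exprD; congr (_ ^+ _); lia.
have qk : q ^+ (2 * k.+1 * (m + 1)) =
    q ^+ (2 * k * (m + 1)) * (X * Y * q ^+ 2).
  by rewrite -qX -!exprD; congr (_ ^+ _); lia.
have Y1 : 1 - Y^-1 != 0.
  rewrite subr_eq0 eq_sym invr_eq1; apply: q1; lia.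
have X0 : X != 0 by apply: expf_neq0.
have Y0 : Y != 0 by apply: expf_neq0.
have Z0 : Z != 0 by apply: expf_neq0.
rewrite qb qk -/X -/Z.
have -> : 1 - X * q ^- (2 * m) = 1 - Y^-1 by rewrite qX invfM mulrA mulfV ?mul1r.
have -> : 1 - Z * q ^- (2 * n) = 1 - (X * q ^+ 2)^-1.
  by rewrite qn invfM mulrCA mulfV ?mulr1.
move: (qpoch q (q ^+ 2) n) (qpoch q (q ^- (2 * m)) d) (qpoch q (q ^+ (2 * b)) k)
  (qpoch q (q ^- (2 * m)) n) (qpoch q (q ^- (2 * n)) k) (q ^+ (2 * k * (m + 1)))
  (qpoch q (q ^+ 2) d) => A B C D E G H IHk.
apply: (mulfI Y1).
transitivity ((A * (B * (1 - Y^-1)) * C) * (1 - Y)); first by ring.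
by rewrite IHk; field; rewrite q0 X0 Y0.
Qed.

Lemma qpoch_phi21E (F : fieldType) (q : F) n1 n2 n3 n1' : q != 0 ->
  (forall i, (0 < i)%N -> q ^+ i != 1) -> (n2 <= n1')%N ->
  qpoch_phi21 q n1 n2 n3 n1' =
  qpoch q (q ^- (2 * n1')) n2 *
  phi21 q (q ^- (2 * n2)) (q ^+ (2 * n1 + 2)) (q ^+ (2 * (n1' - n2 + 1)))
    (q ^- (2 * n3)).
Proof.
move=> q0 q1 n21; rewrite /phi21 /qpoch_phi21.
rewrite -(fsbig_widen `I_n2.+1); [|by []|]; last first.
  move=> k [_] /= /negP; rewrite -leqNgt => kn.
  by rewrite qpoch_expV_eq0// !mul0r.
rewrite -fsbig_ord !big_distrr/=; apply: eq_bigr => k _.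
have kn : (k <= n2)%N by rewrite -ltnS ltn_ord.
have h := qpoch_phi21_term q0 q1 n21 kn.
have b0 : qpoch q (q ^+ (2 * (n1' - n2 + 1))) k != 0 by apply: qpoch_neq0 => //; lia.
have c0 j : qpoch q (q ^+ 2) j != 0 by apply: qpoch_neq0.
have -> : q ^- (2 * n3) ^+ k = q ^- (2 * k * (n1' + n3 + 1)) * q ^+ (2 * k * (n1' + 1)).
  rewrite exprVn -exprM; apply: (mulfI (expf_neq0 (2 * n3 * k) q0)).
  rewrite mulfV ?expf_neq0// mulrCA -exprD mulrC.
  have -> : (2 * n3 * k + 2 * k * (n1' + 1) = 2 * k * (n1' + n3 + 1))%N by lia.
  by rewrite mulfV ?expf_neq0.
apply: (mulIf b0); apply: (mulIf (c0 (n2 - k)%N)).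
transitivity (qpoch q (q ^+ 2) n2 * qpoch q (q ^- (2 * n1')) (n2 - k)
    * qpoch q (q ^+ (2 * (n1' - n2 + 1))) k
    * (qpoch q (q ^+ (2 * n1 + 2)) k / qpoch q (q ^+ 2) k
       * q ^- (2 * k * (n1' + n3 + 1)))).
  by field; rewrite !c0 expf_neq0.
rewrite h; field; by rewrite !c0 b0 expf_neq0.
Qed.

(* The sums over n' have finite support, so no convergence is involved. *)
Lemma finite_conserved (n1 n2 n3 : nat) :
  finite_set [set n' : nat * nat * nat |
    let: (n1', n2', n3') := n' in conserved n1 n2 n3 n1' n2' n3'].
Proof.
pose I := `I_(n1 + n2 + n3).+1.
have fI : finite_set I by exact: finite_II.
apply: (@sub_finite_set _ _ (I `*` I `*` I)); last by do !apply: finite_setX.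
by move=> [[a b] c] /= /andP[/eqP ? /eqP ?]; rewrite /I /=; do !split => /=; lia.
Qed.

Lemma finite_conserved_lhs (n1 n2 n3 n4 n5 n6 : nat)
    (n1'' n2'' n3'' n4'' n5'' n6'' : nat) :
  finite_set [set n' : nat * nat * nat * nat * nat * nat |
    let: (n1', n2', n3', n4', n5', n6') := n' in
    [&& conserved n1 n2 n3 n1' n2' n3', conserved n1' n4 n5 n1'' n4' n5',
        conserved n3' n5' n6' n3'' n5'' n6''
      & conserved n2' n4' n6 n2'' n4'' n6']].
Proof.
pose I := `I_(n1 + n2 + n3 + n4 + n5 + n6).*2.*2.+1.
have fI : finite_set I by exact: finite_II.
apply: (@sub_finite_set _ _ (I `*` I `*` I `*` I `*` I `*` I)); last first.
  by do !apply: finite_setX.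
move=> [[[[[a b] c] d] e] f] /= /and4P[].
move=> /andP[/eqP ? /eqP ?] /andP[/eqP ? /eqP ?].
move=> /andP[/eqP ? /eqP ?] /andP[/eqP ? /eqP ?].
by rewrite /I /=; do !split => /=; lia.
Qed.

Lemma finite_conserved_rhs (n1 n2 n3 n4 n5 n6 : nat)
    (n1'' n2'' n3'' n4'' n5'' n6'' : nat) :
  finite_set [set n' : nat * nat * nat * nat * nat * nat |
    let: (n1', n2', n3', n4', n5', n6') := n' in
    [&& conserved n3 n5 n6 n3' n5' n6', conserved n2 n4 n6' n2' n4' n6'',
        conserved n1 n4' n5' n1' n4'' n5''
      & conserved n1' n2' n3' n1'' n2'' n3'']].
Proof.
pose I := `I_(n1 + n2 + n3 + n4 + n5 + n6).*2.*2.+1.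
have fI : finite_set I by exact: finite_II.
apply: (@sub_finite_set _ _ (I `*` I `*` I `*` I `*` I `*` I)); last first.
  by do !apply: finite_setX.
move=> [[[[[a b] c] d] e] f] /= /and4P[].
move=> /andP[/eqP ? /eqP ?] /andP[/eqP ? /eqP ?].
move=> /andP[/eqP ? /eqP ?] /andP[/eqP ? /eqP ?].
by rewrite /I /=; do !split => /=; lia.
Qed.

(* Main.v *)
(* Put t = q^2.  If x, y, z, u satisfy xy = z - u/t, yx = z - u and z commutes
   with x and y, then y^c x^a z^b is the sum over n' of the weights S with the
   v-dependence removed, times u^b' x^a' y^c': a three-term contiguity relation
   of the 2phi1 sum expresses the effect of multiplying by z.
   Letting x f(v) = f(v/t), y f(v) = (1 - v) f(tv), z = 1, u f(v) = v f(v) act on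
   f = 1 gives the sum rule.
   In a twist of U_q(n+) of type A3, each of the four braid moves relating two
   PBW bases is an instance of the expansion above.  The two paths of moves from
   the first reduced word of the longest element to the last one thus compute
   the coefficients of the same element in the same basis, which is the
   tetrahedron equation without v and w; the parameters contribute the same
   factor to both sides.  Linear independence of the last basis is seen in an
   explicit action of the algebra on functions of six integers. *)
Require Import Defs.
From HB Require Import structures.
From mathcomp Require Import zify ring.
Set Implicit Arguments.
Unset Strict Implicit.
Unset Printing Implicit Defensive.
Local Open Scope ring_scope.

(** * The weights and their contiguity relations *)

Definition core_weight (F : fieldType) (q : F) (n1 n2 n3 n1' n2' n3' : nat) : F :=
  q ^ (((n1 + n3 + n1' + n3' + 2) * n2)%N%:Z - (2 * (n1' + 1) * n2')%N%:Z)
  * (qpoch q (q ^+ 2) n1 * qpoch q (q ^+ 2) n3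
     / (qpoch q (q ^+ 2) n1' * qpoch q (q ^+ 2) n2' * qpoch q (q ^+ 2) n3'))
  * qpoch_phi21 q n1 n2 n3 n1'
  * (conserved n1 n2 n3 n1' n2' n3')%:R.

Lemma SweightE (F : fieldType) (q v : F) n1 n2 n3 n1' n2' n3' :
  Sweight q v n1 n2 n3 n1' n2' n3' =
  core_weight q n1 n2 n3 n1' n2' n3' *
  (v ^+ n2' * (qpoch q (v * q ^- (2 * n1')) n3' / qpoch q v n3)).
Proof. by rewrite /Sweight /core_weight; ring. Qed.

(* A and B stand for (w; t)_i / (t; t)_i and s^k (p; t)_k / (t; t)_k with s
   proportional to w; A1 and B1 are A and B after the substitution w -> t w. *)
Lemma cauchy_product_contiguity (F : fieldType) (t w s p : F) (A A1 B B1 : nat -> F) b :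
  (forall i, (1 - t ^+ i.+1) * A i.+1 = (1 - w * t ^+ i) * A i) ->
  (forall k, (1 - t ^+ k.+1) * B k.+1 = s * (1 - p * t ^+ k) * B k) ->
  (forall i, (1 - w) * A1 i = (1 - w * t ^+ i) * A i) ->
  (forall k, B1 k = t ^+ k * B k) ->
  (1 - t ^+ b.+1) * \sum_(k < b.+2) A (b.+1 - k)%N * B k =
  s * (1 - p * w * t ^+ b) * \sum_(k < b.+1) A (b - k)%N * B k +
  (1 - s * p) * (1 - w) * \sum_(k < b.+1) A1 (b - k)%N * B1 k.
Proof.
move=> hA hB hA1 hB1.
(* Split [1 - t^(b+1)] as [(1 - t^k) + t^k (1 - t^(b+1-k))]: the first part kills the term k = 0 and
   lowers the index of [B], the second kills k = b+1 and lowers the index of [A]. *)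
have -> : (1 - t ^+ b.+1) * \sum_(k < b.+2) A (b.+1 - k)%N * B k =
    \sum_(k < b.+2) (1 - t ^+ k) * B k * A (b.+1 - k)%N +
    \sum_(k < b.+2) t ^+ k * B k * ((1 - t ^+ (b.+1 - k)) * A (b.+1 - k)%N).
  rewrite big_distrr -big_split/=; apply: eq_bigr => k _.
  have -> : t ^+ b.+1 = t ^+ k * t ^+ (b.+1 - k).
    by rewrite -exprD subnKC// -ltnS.
  by ring.
rewrite big_ord_recl expr0 subrr !mul0r add0r.
rewrite [X in _ + X]big_ord_recr/= subnn expr0 subrr mul0r mulr0 addr0.
rewrite !big_distrr -!big_split/=; apply: eq_bigr => k _.
have kb : (k <= b)%N by rewrite -ltnS.
rewrite /bump /= add1n subSS subSn// hB hA hB1.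
have -> : (1 - s * p) * (1 - w) * (A1 (b - k)%N * (t ^+ k * B k)) =
   (1 - s * p) * t ^+ k * B k * ((1 - w) * A1 (b - k)%N) by ring.
rewrite hA1; have -> : t ^+ b = t ^+ k * t ^+ (b - k) by rewrite -exprD subnKC.
by ring.
Qed.

Section CoreWeight.
Variables (F : fieldType) (q : F).
Hypothesis q0 : q != 0.
Hypothesis q1 : forall k : nat, (0 < k)%N -> q ^+ k != 1.
Local Notation t := (q ^+ 2).
Local Notation cw := (core_weight q).

Let tn0 k : t ^+ k != 0. Proof. by rewrite !expf_neq0. Qed.

Lemma qpochq_neq0 k : qpoch q t k != 0.
Proof. exact: qpoch_neq0. Qed.

Lemma qpochqS k : qpoch q t k.+1 = qpoch q t k * (1 - t ^+ k.+1).
Proof. by rewrite qpochS exprM -exprSr. Qed.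

Lemma qpochqSl (w : F) k :
  (1 - w) * qpoch q (t * w) k = (1 - w * t ^+ k) * qpoch q w k.
Proof.
elim: k => [|k IH]; first by rewrite !qpoch0; ring.
by rewrite !qpochS (mulrA (1 - w)) IH exprM (exprS t k); ring.
Qed.

Lemma t_expS_neq1 k : 1 - t ^+ k.+1 != 0.
Proof. by rewrite subr_eq0 eq_sym -exprM q1. Qed.

(** Up to the factor [(t; t)_b] the sum is a Cauchy product depending on [w = t^-a'], and
    multiplying [w] by [t] lowers [a'] by one. *)
Lemma qpoch_phi21_contiguity a b c a' :
  qpoch_phi21 q a b.+1 c a' =
  t ^- (a' + c + 1) * (1 - t ^+ (a + b.+1) / t ^+ a') * qpoch_phi21 q a b c a'
  + (1 - t ^+ a / t ^+ (a' + c)) * (1 - t ^- a') * qpoch_phi21 q a b c a'.-1.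
Proof.
pose w := t ^- a'; pose r := t ^- (c + 1).
pose A w i := qpoch q w i / qpoch q t i.
pose B w k := qpoch q (t ^+ a.+1) k / qpoch q t k * (w * r) ^+ k.
have GE b1 a1 : qpoch_phi21 q a b1 c a1 =
    qpoch q t b1 * \sum_(k < b1.+1) A (t ^- a1) (b1 - k)%N * B (t ^- a1) k.
  rewrite /qpoch_phi21; congr (_ * _); apply: eq_bigr => k _.
  have e : (t ^- a1 * r) ^+ k = q ^- (2 * k * (a1 + c + 1)).
    rewrite /r -invfM -exprD exprVn -!exprM; congr (_ ^+ _)^-1; lia.
  rewrite /A /B e -!exprM.
  have -> : (2 * a + 2 = 2 * a.+1)%N by lia.
  by field; rewrite !qpochq_neq0 expf_neq0.
have hA i : (1 - t ^+ i.+1) * A w i.+1 = (1 - w * t ^+ i) * A w i.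
  rewrite /A qpochqS qpochS exprM.
  by field; rewrite qpochq_neq0 t_expS_neq1.
have hB k : (1 - t ^+ k.+1) * B w k.+1 = (w * r) * (1 - t ^+ a.+1 * t ^+ k) * B w k.
  rewrite /B qpochqS qpochS exprM (exprS (w * r)).
  by field; rewrite qpochq_neq0 t_expS_neq1.
move: hA hB; rewrite {}/w; case: a' => [|a'] hA hB;
  [pose w := t ^- 0|pose w := t ^- a'.+1].
  (* For [a' = 0] the index [a'.-1] is junk, but its term carries the factor [1 - w = 0]. *)
  have w1 : w = 1 by rewrite /w expr0 invr1.
  have := @cauchy_product_contiguity _ t w (w * r) (t ^+ a.+1) (A w)
    (fun i => A (t * w) i) (B w) (fun k => t ^+ k * B w k) b hA hB.
  have h1 i : (1 - w) * A (t * w) i = (1 - w * t ^+ i) * A w i.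
    by rewrite /A mulrA qpochqSl mulrA.
  move=> /(_ h1 (fun=> erefl)).
  rewrite !GE qpochqS -/w => h; rewrite -mulrA h w1.
  rewrite subrr !(mulr0, mul0r) !addr0 /r add0n.
  by rewrite (addnS a) -(addSn a) (exprD t a.+1 b); ring.
pose w1 := t ^- a'.
have w1E : w1 = t * w by rewrite /w1 /w (exprS t) invfM mulrA mulfV ?mul1r ?expf_neq0.
have h1 i : (1 - w) * A w1 i = (1 - w * t ^+ i) * A w i.
  by rewrite w1E /A mulrA qpochqSl mulrA.
have h2 k : B w1 k = t ^+ k * B w k.
  rewrite w1E /B -(mulrA t) (exprMn k t); ring.
have := cauchy_product_contiguity b hA hB h1 h2.
rewrite !GE -/w -/w1 qpochqS => h; rewrite -mulrA h.
have -> : t ^- (a'.+1 + c + 1) = w * r by rewrite /w /r -addnA exprD invfM.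
have -> : t ^+ (a + b.+1) / t ^+ a'.+1 = t ^+ a.+1 * w * t ^+ b.
  by rewrite /w (addnS a) -(addSn a) (exprD t a.+1 b); ring.
have -> : t ^+ a / t ^+ (a'.+1 + c) = w * r * t ^+ a.+1.
  rewrite /w /r !(exprD t) !(exprS t); field.
  by rewrite q0 !tn0.
by ring.
Qed.

Lemma core_weight_notconserved n1 n2 n3 n1' n2' n3' :
  ~~ conserved n1 n2 n3 n1' n2' n3' -> cw n1 n2 n3 n1' n2' n3' = 0.
Proof. by rewrite /core_weight => /negbTE->; rewrite mulr0. Qed.

Lemma core_weightE a b c a' b' c' :
  (a' + b' = a + b)%N -> (c' + b' = b + c)%N ->
  cw a b c a' b' c' =
   q ^+ ((a + c + a' + c' + 2) * b) / q ^+ (2 * (a' + 1) * b') *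
   (qpoch q t a * qpoch q t c / (qpoch q t a' * qpoch q t b' * qpoch q t c')) *
   qpoch_phi21 q a b c a'.
Proof.
move=> h1 h2.
rewrite /core_weight /conserved -h1 (addnC b') h2 !eqxx mulr1 expfzDr//.
by rewrite -exprnN -exprnP.
Qed.

Lemma expr_div_eq m n k l : (m + l = k + n)%N -> q ^+ m / q ^+ n = q ^+ k / q ^+ l.
Proof.
move=> h; apply/eqP; rewrite eqr_div ?expf_neq0//; apply/eqP.
by rewrite -!exprD h.
Qed.

(** Mirrors the substitution [z = x y + t^-1 u]: the first term comes from [x y], the second from
    [t^-1 u], where [u] passes [x^a'] at the cost of [t^-a']. *)
Lemma core_weight_rec_mid a b c a' b' c' :
  (a' + b' = a + b.+1)%N -> (c' + b' = b.+1 + c)%N ->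
  cw a b.+1 c a' b' c' =
  (if (a' > 0)%N && (c' > 0)%N then cw a b c a'.-1 b' c'.-1 else 0) +
  (if (b' > 0)%N then t ^- a'.+1 * cw a b c a' b'.-1 c' else 0).
Proof.
move=> h1 h2; rewrite core_weightE//.
rewrite qpoch_phi21_contiguity// (mulrDr _ (_ * _)) addrC; congr (_ + _).
(* Conservation gives [a' + c = a + c']. The factors [1 - t^-a'] and [1 - t^-c'] vanish exactly
   where a predecessor would be junk. *)
- have -> : t ^+ a / t ^+ (a' + c) = t ^- c'.
    rewrite -!exprM; have -> : (2 * (a' + c) = 2 * a + 2 * c')%N by lia.
    by rewrite exprD invfM mulrA mulfV ?mul1r// expf_neq0.
  case: ifPn => [/andP[]|]; last first.
    rewrite negb_and -!leqNgt !leqn0 => /orP[]/eqP->;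
      by rewrite expr0 invr1 subrr !(mulr0,mul0r).
  case: a' h1 => // a' h1; case: c' h2 => // c' h2 _ _.
  rewrite core_weightE/= ; [|lia|lia].
  have -> : q ^+ ((a + c + a'.+1 + c'.+1 + 2) * b.+1) / q ^+ (2 * (a'.+1 + 1) * b') =
    q ^+ ((a + c + a' + c' + 2) * b) / q ^+ (2 * (a' + 1) * b') * (t ^+ a'.+1 * t ^+ c'.+1).
    rewrite -!exprM -exprD mulrAC -exprD; apply: expr_div_eq; lia.
  rewrite !(qpochqS a') !(qpochqS c').
  by field; rewrite !qpochq_neq0// !t_expS_neq1// !tn0 !expf_neq0.
case: b' h1 h2 => [|b'] h1 h2.
  have -> : t ^+ (a + b.+1) / t ^+ a' = 1 by rewrite -h1 addn0 mulfV.
  by rewrite subrr !(mulr0,mul0r).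
rewrite core_weightE/= ; [|lia|lia].
have -> : t ^+ (a + b.+1) / t ^+ a' = t ^+ b'.+1.
  by rewrite -h1 exprD mulrAC mulfV ?mul1r.
have -> : q ^+ ((a + c + a' + c' + 2) * b.+1) / q ^+ (2 * (a' + 1) * b'.+1) =
    q ^+ ((a + c + a' + c' + 2) * b) / q ^+ (2 * (a' + 1) * b') *
    (t ^+ (a' + c + 1) / t ^+ a'.+1).
  rewrite -!exprM mulrACA -exprD -invfM -exprD; apply: expr_div_eq; lia.
rewrite !(qpochqS b').
by field; rewrite !qpochq_neq0// !t_expS_neq1// !tn0 !expf_neq0.
Qed.

Lemma qpoch_phi21_0 a c a' : qpoch_phi21 q a 0 c a' = 1.
Proof.
by rewrite /qpoch_phi21 big_ord1 !qpoch0 muln0 mul0n expr0 !(mulr1, invr1).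
Qed.

(** Mirrors multiplying [u^j x^(a-j) y^(c-j)] by [y] on the left: [y] either joins the other [y]'s
    or merges with an [x] into [u]. For [b = 0] the series is 1, so the weights are explicit
    quotients. *)
Lemma core_weight_rec_right a c j : (j <= a)%N -> (j <= c.+1)%N ->
  cw a 0 c.+1 (a - j) j (c.+1 - j) =
  t ^+ j * (if (j <= c)%N then cw a 0 c (a - j) j (c - j) else 0) +
  (if (j > 0)%N then
     t ^+ j.-1 * (t ^- (a - j.-1) - 1) * cw a 0 c (a - j.-1) j.-1 (c - j.-1)
   else 0).
Proof.
move=> ja jc; rewrite core_weightE; [|lia|lia].
have -> : t ^+ j * (if (j <= c)%N then cw a 0 c (a - j) j (c - j) else 0) =
  t ^+ j * (1 - t ^+ (c.+1 - j)) / (1 - t ^+ c.+1) *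
  (q ^- (2 * (a - j + 1) * j) * (qpoch q t a * qpoch q t c.+1 /
   (qpoch q t (a - j) * qpoch q t j * qpoch q t (c.+1 - j)))).
  case: ifPn => jc'.
    rewrite core_weightE; [|lia|lia].
    rewrite muln0 expr0 qpoch_phi21_0 subSn// !(qpochqS (_ - _)) !(qpochqS c).
    by field; rewrite !qpochq_neq0// !t_expS_neq1// !expf_neq0.
  have -> : (c.+1 - j = 0)%N by lia.
  by rewrite expr0 subrr !(mulr0,mul0r).
rewrite muln0 expr0 mul1r qpoch_phi21_0 mulr1.
case: j ja jc => [|j] ja jc.
  by rewrite subn0 expr0 mul1r divff ?t_expS_neq1// mul1r addr0.
rewrite /= core_weightE; [|lia|lia].
rewrite subSS muln0 qpoch_phi21_0 expr0.
have -> : (a - j = (a - j.+1).+1)%N by lia.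
set m := (a - j.+1)%N.
rewrite !(qpochqS m) !(qpochqS j) !(qpochqS c).
have -> : q ^- (2 * (m + 1) * j.+1) =
    q ^- (2 * (m.+1 + 1) * j) * (t ^+ j / t ^+ m.+1).
  transitivity (t ^+ j / (q ^+ (2 * (m.+1 + 1) * j) * t ^+ m.+1)).
    have -> : q ^+ (2 * (m.+1 + 1) * j) * t ^+ m.+1 = q ^+ (2 * (m + 1) * j.+1) * t ^+ j.
      rewrite -!exprM -!exprD; congr (_ ^+ _); lia.
    by field; rewrite !expf_neq0.
  by field; rewrite !expf_neq0.
have -> : t ^+ c.+1 = t ^+ j.+1 * t ^+ (c - j) by rewrite -exprD; congr (_ ^+ _); lia.
have : 1 - t ^+ j.+1 * t ^+ (c - j) != 0.
  have -> : t ^+ j.+1 * t ^+ (c - j) = t ^+ c.+1 by rewrite -exprD; congr (_ ^+ _); lia.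
  exact: t_expS_neq1.
have := t_expS_neq1 j; have := t_expS_neq1 m; rewrite !(exprS t j).
by move=> n1 n2 n3; field; rewrite !qpochq_neq0// n1 n2 n3 !expf_neq0.
Qed.

(** Truncated subtraction creates no spurious terms, since conservation then fails; the recursions
    can thus be stated for every [j]. *)
Lemma core_weight_out a b c j : ~~ ((j <= a + b) && (j <= b + c))%N ->
  cw a b c (a + b - j) j (b + c - j) = 0.
Proof.
move=> h; apply: core_weight_notconserved; apply: contraNN h; rewrite /conserved; lia.
Qed.

Lemma core_weight0_out a c j : ~~ ((j <= a) && (j <= c))%N ->
  cw a 0 c (a - j) j (c - j) = 0.
Proof. by have := @core_weight_out a 0 c j; rewrite addn0 add0n. Qed.

Lemma core_weight_right_S a c j :
  cw a 0 c.+1 (a - j) j (c.+1 - j) =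
  t ^+ j * cw a 0 c (a - j) j (c - j) +
  (if (j > 0)%N then
     t ^+ j.-1 * (t ^- (a - j.-1) - 1) * cw a 0 c (a - j.-1) j.-1 (c - j.-1)
   else 0).
Proof.
have [/andP[ja jc]|h] := boolP ((j <= a) && (j <= c.+1))%N.
  rewrite core_weight_rec_right//; case: ifPn => // jc'.
  by rewrite (@core_weight0_out a c j)// negb_and jc' orbT.
rewrite core_weight0_out// core_weight0_out ?mulr0 ?add0r; last first.
  by apply: contraNN h; lia.
(* At [j = a] the weight itself may be nonzero, but its coefficient contains [t^0 - 1]. *)
case: j h => [//|j] h /=; have [ja|ja] := eqVneq j a.
  by rewrite ja subnn expr0 invr1 subrr mulr0 mul0r.
rewrite core_weight0_out ?mulr0//; apply: contraNN h; lia.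
Qed.

Lemma core_weight_mid_S a b c j :
  cw a b.+1 c (a + b.+1 - j) j (b.+1 + c - j) =
  cw a b c (a + b - j) j (b + c - j) +
  (if (j > 0)%N then
     t ^- (a + b - j.-1).+1 * cw a b c (a + b - j.-1) j.-1 (b + c - j.-1)
   else 0).
Proof.
have [/andP[ja jc]|h] := boolP ((j <= a + b.+1) && (j <= b.+1 + c))%N; last first.
  rewrite !core_weight_out ?mulr0 ?if_same ?addr0//; apply: contraNN h; lia.
rewrite core_weight_rec_mid; [|lia|lia]; congr (_ + _); last first.
  case: j ja jc => // j ja jc /=; congr (_ * _); first by congr (_ ^+ _)^-1; lia.
  by congr core_weight; lia.
case: ifPn => h; first by congr core_weight; lia.
by rewrite core_weight_out//; apply: contraNN h; lia.
Qed.

End CoreWeight.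

(** * Normal ordering in the homogenized q-oscillator algebra *)

Section IterLinear.
Variables (F : fieldType) (V : lmodType F).
Implicit Types x y : {linear V -> V}.

Lemma iter_linear n x : linear (iter n x).
Proof. by elim: n => [//|n IH] a f g; rewrite !iterS IH linearP. Qed.

HB.instance Definition _ n x :=
  GRing.isLinear.Build F V V _ (iter n x) (iter_linear n x).

Lemma iter_qcomm (c : F) x y m n f :
  (forall f, x (y f) = c *: y (x f)) ->
  iter m x (iter n y f) = c ^+ (m * n) *: iter n y (iter m x f).
Proof.
move=> xy; have xyn k g : x (iter k y g) = c ^+ k *: iter k y (x g).
  elim: k => [|k IH]; first by rewrite scale1r.
  by rewrite iterS xy IH linearZ/= scalerA -exprS.
elim: m => [|m IH]; first by rewrite mul0n scale1r.
by rewrite iterS IH linearZ/= xyn scalerA -exprD -iterS mulSn addnC.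
Qed.

Lemma iter_comm x y m n f :
  (forall f, x (y f) = y (x f)) -> iter m x (iter n y f) = iter n y (iter m x f).
Proof.
move=> xy; rewrite (@iter_qcomm 1) ?expr1n ?scale1r// => g.
by rewrite scale1r.
Qed.

End IterLinear.

Section TripleOperators.
Variables (F : fieldType) (q : F) (V : lmodType F).
Hypothesis q0 : q != 0.
Hypothesis q1 : forall k : nat, (0 < k)%N -> q ^+ k != 1.
Local Notation t := (q ^+ 2).
Local Notation cw := (core_weight q).

Let t0 : t != 0. Proof. by rewrite expf_neq0. Qed.

(* A homogenized q-oscillator algebra: in a cocycle twist of U_q(n+) of type A2,
   x and y are the simple root vectors, and z and u the two root vectors of the
   highest root; the twist, which makes z central, is dictated by the powers of
   q in S. *)
Definition triple (x z u y : V -> V) :=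
  [/\ forall f, x (y f) = z f - t^-1 *: u f, forall f, y (x f) = z f - u f,
      forall f, z (x f) = x (z f) & forall f, z (y f) = y (z f)].

Variables x z u y : {linear V -> V}.
Hypothesis xzuy : triple x z u y.

Let xy f : x (y f) = z f - t^-1 *: u f. Proof. by case: xzuy. Qed.
Let yx f : y (x f) = z f - u f. Proof. by case: xzuy. Qed.
Let zx f : z (x f) = x (z f). Proof. by case: xzuy. Qed.
Let zy f : z (y f) = y (z f). Proof. by case: xzuy. Qed.
Let u_yx f : u f = z f - y (x f). Proof. by rewrite yx subKr. Qed.
Let u_xy f : u f = t *: (z f - x (y f)).
Proof. by rewrite xy subKr scalerA mulfV// scale1r. Qed.

Lemma triple_zx f : z (x f) = x (z f). Proof. exact: zx. Qed.

(** From [u = t (z - x y)] and [(z - x y) x = x (z - y x) = x u]. The relation with [y] follows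
    likewise from [u = z - y x]. *)
Lemma triple_ux f : u (x f) = t *: x (u f).
Proof. by rewrite u_xy yx (linearB x)/= zx subKr. Qed.

Lemma triple_yu f : y (u f) = t *: u (y f).
Proof.
by rewrite (u_yx (y f)) xy (linearB y)/= zy subKr linearZ/= scalerA mulfV// scale1r.
Qed.

Lemma triple_xu_iter n f : iter n x (u f) = t ^- n *: u (iter n x f).
Proof.
have := iter_qcomm 1 n f triple_ux; rewrite /= mul1n => ->.
by rewrite scalerA mulVf ?scale1r ?expf_neq0.
Qed.

Lemma triple_y_xn n f :
  y (iter n x f) = iter n x (y f) + (t ^- n - 1) *: u (iter n.-1 x f).
Proof.
case: n => [|n]; first by rewrite expr0 invr1 subrr scale0r addr0.
rewrite iterS yx iterSr xy linearB/= linearZ/= triple_xu_iter scalerA -invfM -exprS.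
have -> : iter n x (z f) = z (iter n x f).
  by have := iter_comm 1 n f zx.
by rewrite scalerBl scale1r addrA subrK.
Qed.

Lemma triple_normal_order0 a c B f : (c < B)%N ->
  iter c y (iter a x f) =
  \sum_(j < B) cw a 0 c (a - j) j (c - j) *:
     iter j u (iter (a - j) x (iter (c - j) y f)).
Proof.
elim: c B f => [|c IH] [//|B] f cB.
  rewrite big_ord_recl/= !subn0 core_weightE// qpoch_phi21_0 !muln0 expr0.
  rewrite invr1 qpoch0 !mulr1 mul1r mulfV ?qpochq_neq0// scale1r.
  rewrite big1 ?addr0// => j _; rewrite core_weight_notconserved ?scale0r//.
  rewrite /conserved negb_and -orbC; apply/orP; left; rewrite /bump /=; lia.
pose W j := iter j u (iter (a - j) x (iter (c.+1 - j) y f)).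
(* Applying [y] to the [j]-th summand yields multiples of [W j] and [W j.+1]; after a shift of index
   these are the two terms of [core_weight_right_S]. *)
transitivity (\sum_(j < B)
  (t ^+ j * cw a 0 c (a - j) j (c - j) *: W j +
   t ^+ j * (t ^- (a - j) - 1) * cw a 0 c (a - j) j (c - j) *: W j.+1)).
  rewrite iterS (IH B)// linear_sum/=; apply: eq_bigr => j _.
  rewrite linearZ/=.
  have [jc|jc] := leqP j c; last first.
    rewrite core_weight_notconserved ?mulr0 ?scale0r ?addr0//.
    by rewrite /conserved negb_and; apply/orP; right; lia.
  have := iter_qcomm 1 j (iter (a - j) x (iter (c - j) y f)) triple_yu.
  rewrite mul1n /= => ->; rewrite triple_y_xn !linearD/= !linearZ/=.
  rewrite /W subSn// subSS -iterS -iterSr subnS !scalerA.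
  by congr (_ *: _ + _ *: _); ring.
rewrite big_split/=.
under [RHS]eq_bigr do rewrite core_weight_right_S// scalerDl.
rewrite [RHS]big_split; congr (_ + _).
  rewrite big_ord_recr/= [X in _ + X](_ : _ = 0) ?addr0//.
  by rewrite core_weight0_out ?mulr0 ?scale0r//; apply/negP; lia.
by rewrite [RHS]big_ord_recl/= scale0r add0r.
Qed.

Lemma triple_normal_order a b c B f : (b + c < B)%N ->
  iter c y (iter a x (iter b z f)) =
  \sum_(j < B) cw a b c (a + b - j) j (b + c - j) *:
     iter j u (iter (a + b - j) x (iter (b + c - j) y f)).
Proof.
elim: b B f => [|b IH] B f bB; first by rewrite addn0 add0n -triple_normal_order0.
case: B bB => [//|B] bB.
pose W j := iter j u (iter (a + b.+1 - j) x (iter (b.+1 + c - j) y f)).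
transitivity (\sum_(j < B)
  (cw a b c (a + b - j) j (b + c - j) *: W j +
   t ^- (a + b - j).+1 * cw a b c (a + b - j) j (b + c - j) *: W j.+1)).
  (* The innermost [z] moves left through the [y]'s and is there replaced by [x y + t^-1 u]; then
     [u] passes the [x]'s. *)
  rewrite iterSr (IH B)//; apply: eq_bigr => j _.
  have [/andP[ja jc]|h] := boolP ((j <= a + b) && (j <= b + c))%N; last first.
    rewrite core_weight_notconserved ?mulr0 ?scale0r ?addr0//.
    by move: h; apply: contraNN; rewrite /conserved; lia.
  have -> : iter (b + c - j) y (z f) = z (iter (b + c - j) y f).
    by have := iter_comm 1 (b + c - j) f zy.
  have zE g : z g = x (y g) + t^-1 *: u g by rewrite xy subrK.
  rewrite zE !linearD/= !linearZ/= triple_xu_iter !linearZ/= !scalerA.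
  rewrite /W addnS addSn !subSS !subSn// -!iterSr -!iterS.
  by congr (_ + _ *: _); rewrite (exprS t); field; rewrite q0 expf_neq0.
rewrite big_split/=.
under [RHS]eq_bigr do rewrite core_weight_mid_S// scalerDl.
rewrite [RHS]big_split; congr (_ + _).
  rewrite big_ord_recr/= [X in _ + X](_ : _ = 0) ?addr0//.
  by rewrite core_weight_out ?scale0r//; apply/negP; lia.
by rewrite [RHS]big_ord_recl/= scale0r add0r.
Qed.

End TripleOperators.

(** * Normal ordering as a sum over a finite box of indices *)

Local Open Scope classical_set_scope.

Lemma fsbig_inj (F : fieldType) (T : finType) (U : choiceType) (h : T -> U) (G : U -> F) :
  injective h -> (forall u, G u != 0 -> exists t, u = h t) ->
  \sum_(u \in [set: U]) G u = \sum_t G (h t).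
Proof.
move=> hI hG.
rewrite (fsbigE [seq h x | x <- index_enum T])//; first last.
- move=> u _; apply: contraNeq => /hG[x ->].
  by apply: map_f; rewrite mem_index_enum.
- by rewrite map_inj_uniq// index_enum_uniq.
by rewrite big_map; apply: eq_bigl => x; rewrite in_setT.
Qed.

Lemma big_ord_only (V : nmodType) B N (G : nat -> V) :
  (N < B)%N -> (forall i, i != N -> G i = 0) -> \sum_(i < B) G i = G N.
Proof.
move=> NB G0; rewrite (bigD1 (Ordinal NB))//= big1 ?addr0// => i iN.
by apply: G0.
Qed.

Section Expansion.
Variables (F : fieldType) (q : F) (V : lmodType F).
Hypothesis q0 : q != 0.
Hypothesis q1 : forall k : nat, (0 < k)%N -> q ^+ k != 1.
Local Notation cw := (core_weight q).
Variables x z u y : {linear V -> V}.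
Hypothesis xzuy : triple q x z u y.

(** In a chain of expansions [e] contains the product of the earlier weights, and their conservation
    laws bound [a], [b], [c] only when it is nonzero; hence the form of the hypothesis. *)
Lemma triple_expand B (e : F) a b c f : (e != 0 -> (a + b + c < B)%N) ->
  e *: iter c y (iter a x (iter b z f)) =
  \sum_(m : 'I_B * 'I_B * 'I_B) (e * cw a b c m.1.1 m.1.2 m.2) *:
     iter m.1.2 u (iter m.1.1 x (iter m.2 y f)).
Proof.
have [->|e0 /(_ isT) abcB] := eqVneq e 0.
  by rewrite scale0r big1// => m _; rewrite mul0r scale0r.
pose W i j k := (e * cw a b c i j k) *: iter j u (iter i x (iter k y f)).
transitivity (\sum_(i < B) \sum_(j < B) \sum_(k < B) W i j k); last first.
  by rewrite pair_big pair_big.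
rewrite exchange_big/=.
rewrite (triple_normal_order q0 q1 xzuy _ _ (_ : b + c < B)%N) ?scaler_sumr; last by lia.
apply: eq_bigr => j _; rewrite scalerA -/(W (a + b - j)%N j (b + c - j)%N).
have W0 i k : ~~ conserved a b c i j k -> W i j k = 0.
  by move=> h; rewrite /W core_weight_notconserved// mulr0 scale0r.
rewrite (@big_ord_only _ _ (a + b - j)%N (fun i => \sum_(k < B) W i j k));
    [|lia|]; last first.
  by move=> i h; rewrite big1// => k _; apply: W0; rewrite /conserved; lia.
rewrite (@big_ord_only _ _ (b + c - j)%N (W (a + b - j)%N j))//; first by lia.
by move=> k h; apply: W0; rewrite /conserved; lia.
Qed.

Lemma triple_expand_in (L : {linear V -> V}) B (e : F) a b c f :
  (e != 0 -> (a + b + c < B)%N) ->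
  e *: L (iter c y (iter a x (iter b z f))) =
  \sum_(m : 'I_B * 'I_B * 'I_B) (e * cw a b c m.1.1 m.1.2 m.2) *:
     L (iter m.1.2 u (iter m.1.1 x (iter m.2 y f))).
Proof.
move=> h; rewrite -linearZ/= (triple_expand _ h) linear_sum.
by apply: eq_bigr => m _; rewrite linearZ.
Qed.

End Expansion.

(** * The sum rule *)

Section SumRule.
Variables (F : fieldType) (q : F).
Hypothesis q0 : q != 0.
Hypothesis q1 : forall k : nat, (0 < k)%N -> q ^+ k != 1.
Local Notation t := (q ^+ 2).
Local Notation V := (F -> F^o).

Definition shift_op (f : V) : V := fun v => f (t^-1 * v).
Definition weighted_shift_op (f : V) : V := fun v => (1 - v) * f (t * v).
Definition position_op (f : V) : V := fun v => v * f v.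

Lemma shift_op_linear : linear shift_op. Proof. by []. Qed.
Lemma weighted_shift_op_linear : linear weighted_shift_op.
Proof.
move=> a f g; apply/funext => v.
by rewrite /weighted_shift_op !fctE /GRing.scale/=; ring.
Qed.
Lemma position_op_linear : linear position_op.
Proof.
move=> a f g; apply/funext => v.
by rewrite /position_op !fctE /GRing.scale/=; ring.
Qed.
HB.instance Definition _ := GRing.isLinear.Build F V V _ shift_op shift_op_linear.
HB.instance Definition _ :=
  GRing.isLinear.Build F V V _ weighted_shift_op weighted_shift_op_linear.
HB.instance Definition _ := GRing.isLinear.Build F V V _ position_op position_op_linear.

Lemma triple_shift : triple q shift_op idfun position_op weighted_shift_op.
Proof.
have t0 : t != 0 by rewrite expf_neq0.
split=> // f; apply/funext => v;
  rewrite /shift_op /weighted_shift_op /position_op !fctE /GRing.scale/=.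
  by rewrite (mulrA t) mulfV// mul1r; ring.
by rewrite (mulrA t^-1) mulVf// mul1r; ring.
Qed.

Lemma iter_shift_op n f v : iter n shift_op f v = f (v * q ^- (2 * n)).
Proof.
elim: n v => [|n IH] v; first by rewrite muln0 expr0 divr1.
by rewrite iterS /shift_op IH; congr f; rewrite mulnS exprD; field; rewrite q0 expf_neq0.
Qed.

Lemma iter_weighted_shift_op n v :
  iter n weighted_shift_op (cst 1) v = qpoch q v n.
Proof.
elim: n v => [|n IH] v; first by rewrite qpoch0.
by rewrite iterS /weighted_shift_op IH qpochqSl qpochS exprM mulrC (mulrC v).
Qed.

Lemma iter_position_op n f v : iter n position_op f v = v ^+ n * f v.
Proof.
elim: n => [|n IH]; first by rewrite mul1r.
by rewrite iterS /position_op IH exprS mulrA.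
Qed.

Lemma core_weight_sum v a b c B : (a + b + c < B)%N ->
  qpoch q v c = \sum_(m : 'I_B * 'I_B * 'I_B)
    core_weight q a b c m.1.1 m.1.2 m.2 *
    (v ^+ m.1.2 * qpoch q (v * q ^- (2 * m.1.1)) m.2).
Proof.
move=> abcB.
(* The operators [x] and [z] fix the constant 1, so the left side is [y^c 1 = (v; t)_c]. *)
have := @triple_expand _ q _ q0 q1 _ _ _ _ triple_shift B 1 a b c (cst 1) (fun=> abcB).
have -> : iter b idfun (cst 1 : V) = cst 1 by elim: b {abcB} => // b IH; rewrite iterS.
have -> n : iter n shift_op (cst 1) = cst 1.
  by apply/funext => w; rewrite iter_shift_op.
move=> /(congr1 (fun g => g v)); rewrite scale1r iter_weighted_shift_op => ->.
rewrite fct_sumE; apply: eq_bigr => m _.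
by rewrite mul1r !fctE iter_position_op iter_shift_op iter_weighted_shift_op.
Qed.

Lemma sum_Sweight v a b c : qpoch q v c != 0 ->
  \sum_(n' \in [set: nat * nat * nat])
    (let: (n1', n2', n3') := n' in Sweight q v a b c n1' n2' n3') = 1.
Proof.
move=> vc; pose B := (a + b + c).+1.
pose h (m : 'I_B * 'I_B * 'I_B) := (m.1.1 : nat, m.1.2 : nat, m.2 : nat).
rewrite (fsbig_inj (h := h)); first last.
- move=> [[i j] k]; have [|nc] := boolP (conserved a b c i j k); last first.
    by rewrite SweightE core_weight_notconserved// mul0r eqxx.
  move=> /andP[/eqP h1 /eqP h2] _.
  have iB : (i < B)%N by rewrite /B; lia.
  have jB : (j < B)%N by rewrite /B; lia.
  have kB : (k < B)%N by rewrite /B; lia.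
  by exists (Ordinal iB, Ordinal jB, Ordinal kB).
- move=> [[i j] k] [[i' j'] k'] [] h1 h2 h3.
  by congr (_, _, _); apply: val_inj.
transitivity ((qpoch q v c)^-1 * qpoch q v c); last by rewrite mulVf.
rewrite {2}(core_weight_sum v (ltnSn (a + b + c))) big_distrr/=.
by apply: eq_bigr => -[[i j] k] _; rewrite SweightE /=; ring.
Qed.

End SumRule.

Lemma core_weight_conserved (F : fieldType) (q : F) a b c a' b' c' :
  core_weight q a b c a' b' c' != 0 -> (a + b = a' + b')%N /\ (b + c = b' + c')%N.
Proof.
have [/andP[/eqP ? /eqP ?]//|h] := boolP (conserved a b c a' b' c').
by rewrite core_weight_notconserved// eqxx.
Qed.

Lemma mulf_neq0W (F : fieldType) (a b : F) : a * b != 0 -> a != 0 /\ b != 0.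
Proof. by rewrite mulf_eq0 negb_or => /andP[]. Qed.

(** * Two paths of braid moves in type A3 *)

Section Words.
Variables (F : fieldType) (q : F) (V : lmodType F).
Hypothesis q0 : q != 0.
Hypothesis q1 : forall k : nat, (0 < k)%N -> q ^+ k != 1.
Local Notation t := (q ^+ 2).
Local Notation cw := (core_weight q).

Let t_neq0 : t != 0. Proof. by rewrite expf_neq0. Qed.

Variables x1 x2 x3 z12 z23 z123 u12 u23 u1_23 u12_3 u123 : {linear V -> V}.
Hypothesis T1 : triple q x1 z12 u12 x2.
Hypothesis T2 : triple q x1 z123 u1_23 z23.
Hypothesis T3 : triple q u12 u1_23 u123 x3.
Hypothesis T4 : triple q x2 z23 u23 x3.
Hypothesis T5 : triple q z12 z123 u12_3 x3.
Hypothesis T6 : triple q x1 u12_3 u123 u23.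
Hypothesis c13 : forall f, x1 (x3 f) = x3 (x1 f).
Hypothesis z123_x2 : forall f, z123 (x2 f) = x2 (z123 f).
Hypothesis z23_u12 : forall f, z23 (u12 f) = t *: u12 (z23 f).
Hypothesis u23_z12 : forall f, u23 (z12 f) = t *: z12 (u23 f).
Hypothesis x2_u123 : forall f, x2 (u123 f) = u123 (x2 f).

Variables (n1 n2 n3 n4 n5 n6 B : nat).
Hypothesis nB : (10 * (n1 + n2 + n3 + n4 + n5 + n6) < B)%N.

(** Both paths can start here: [x2], [x1], [z12] are adjacent, as [T1] requires, and [x3], [x2],
    [z23] become adjacent in the order of [T4] because [z23] commutes with [x2]. *)
Definition initial_word f :=
  iter n6 x3 (iter n5 z23 (iter n3 x2 (iter n1 x1 (iter n2 z12 (iter n4 z123 f))))).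

Definition final_word m1 m2 m3 m4 m5 m6 f :=
  iter m4 u123 (iter m2 u12 (iter m1 x1 (iter m5 u23 (iter m3 x2 (iter m6 x3 f))))).

(* The expansions of initial_word along the two paths of braid moves; the powers
   of t come from reordering t-commuting root vectors. *)
Definition lhs_words f :=
  \sum_(m1 : 'I_B * 'I_B * 'I_B) \sum_(m2 : 'I_B * 'I_B * 'I_B)
  \sum_(m3 : 'I_B * 'I_B * 'I_B) \sum_(m4 : 'I_B * 'I_B * 'I_B)
   (t ^+ (n5 * m1.1.2) * cw n1 n2 n3 m1.1.1 m1.1.2 m1.2
    * cw m1.1.1 n4 n5 m2.1.1 m2.1.2 m2.2
    * cw m1.1.2 m2.1.2 n6 m3.1.1 m3.1.2 m3.2
    * cw m1.2 m2.2 m3.2 m4.1.1 m4.1.2 m4.2)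
   *: final_word m2.1.1 m3.1.1 m4.1.1 m3.1.2 m4.1.2 m4.2 f.

Definition rhs_words f :=
  \sum_(m1 : 'I_B * 'I_B * 'I_B) \sum_(m2 : 'I_B * 'I_B * 'I_B)
  \sum_(m3 : 'I_B * 'I_B * 'I_B) \sum_(m4 : 'I_B * 'I_B * 'I_B)
   (t ^+ (m1.1.2 * m1.1.1) * cw n3 n5 n6 m1.1.1 m1.1.2 m1.2
    * cw n2 n4 m1.2 m2.1.1 m2.1.2 m2.2
    * (t ^+ (m3.2 * m2.1.1) * cw n1 m2.1.2 m1.1.2 m3.1.1 m3.1.2 m3.2)
    * (t ^- (m3.2 * m4.2) * cw m3.1.1 m2.1.1 m1.1.1 m4.1.1 m4.1.2 m4.2))
   *: final_word m4.1.1 m4.1.2 m4.2 m3.1.2 m3.2 m2.2 f.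

Lemma initial_word_lhs f : initial_word f = lhs_words f.
Proof.
rewrite /initial_word -[LHS]scale1r.
have b1 : (1 : F) != 0 -> (n1 + n2 + n3 < B)%N by lia.
have /= -> := triple_expand_in q0 q1 T1 (iter n6 x3 \o iter n5 z23) (iter n4 z123 f) b1.
apply: eq_bigr => -[[i j] k] _ /=; rewrite mul1r.
(* Moving [z23] past [u12] and [z123] past [x2] brings together the block [z23 x1 z123] of [T2]. *)
rewrite (iter_qcomm _ _ _ z23_u12) linearZ/= scalerA -(iter_comm n4 k f z123_x2).
rewrite [_ * t ^+ _]mulrC; set e1 := _ * _.
have b2 : e1 != 0 -> (i + n4 + n5 < B)%N.
  move=> /mulf_neq0W[_ /core_weight_conserved[h1 h2]]; lia.
have /= -> := triple_expand_in q0 q1 T2 (iter n6 x3 \o iter j u12) (iter k x2 f) b2.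
apply: eq_bigr => -[[i2 j2] k2] _ /=; set e2 := e1 * _.
have b3 : e2 != 0 -> (j + j2 + n6 < B)%N.
  move=> /mulf_neq0W[/mulf_neq0W[_ /core_weight_conserved[h1 h2]]].
  by move=> /core_weight_conserved[h3 h4]; lia.
rewrite (triple_expand q0 q1 T3 _ b3).
apply: eq_bigr => -[[i3 j3] k3] _ /=.
(* This reordering produces the block [x3 x2 z23] of [T4]. *)
rewrite -(iter_comm i2 k3 _ c13) (iter_comm k2 k f (triple_zx T4)).
set e3 := e2 * _.
have b4 : e3 != 0 -> (k + k2 + k3 < B)%N.
  move=> /mulf_neq0W[/mulf_neq0W[/mulf_neq0W[_ /core_weight_conserved[h1 h2]]]].
  by move=> /core_weight_conserved[h3 h4] /core_weight_conserved[h5 h6]; lia.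
exact: (triple_expand_in q0 q1 T4 (iter j3 u123 \o iter i3 u12 \o iter i2 x1) f b4).
Qed.

Lemma initial_word_rhs f : initial_word f = rhs_words f.
Proof.
rewrite /initial_word (iter_comm n5 n3 _ (triple_zx T4)) -[LHS]scale1r.
have b1 : (1 : F) != 0 -> (n3 + n5 + n6 < B)%N by lia.
rewrite (triple_expand q0 q1 T4 _ b1).
apply: eq_bigr => -[[i j] k] _ /=; rewrite mul1r.
(* Now [x3] meets [z12 z123], the block of [T5], and [u23] stands next to [x1] for the later use of
   [T6]. *)
rewrite (iter_qcomm _ _ _ (triple_ux q0 T4)) scalerA -(iter_comm n1 k _ c13).
rewrite [_ * t ^+ _]mulrC; set e1 := _ * _.
have b2 : e1 != 0 -> (n2 + n4 + k < B)%N.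
  move=> /mulf_neq0W[_ /core_weight_conserved[h1 h2]]; lia.
have /= -> := triple_expand_in q0 q1 T5 (iter i x2 \o iter j u23 \o iter n1 x1) f b2.
apply: eq_bigr => -[[i2 j2] k2] _ /=; set e2 := e1 * _.
have b3 : e2 != 0 -> (n1 + j2 + j < B)%N.
  move=> /mulf_neq0W[/mulf_neq0W[_ /core_weight_conserved[h1 h2]]].
  by move=> /core_weight_conserved[h3 h4]; lia.
have /= -> := triple_expand_in q0 q1 T6 (iter i x2) (iter i2 z12 (iter k2 x3 f)) b3.
apply: eq_bigr => -[[i3 j3] k3] _ /=.
(* With [u23] moved right and [x2] moved past [u123], the block [x2 x1 z12] of [T1] appears. *)
rewrite (iter_qcomm _ _ _ u23_z12) !linearZ/= scalerA (iter_comm _ _ _ x2_u123).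
rewrite mulrCA; set e3 := e2 * _.
have b4 : e3 != 0 -> (i3 + i2 + i < B)%N.
  move=> /mulf_neq0W[/mulf_neq0W[/mulf_neq0W[_ /core_weight_conserved[h1 h2]]]].
  move=> /core_weight_conserved[h3 h4] /mulf_neq0W[_ /core_weight_conserved[h5 h6]]; lia.
have /= -> := triple_expand_in q0 q1 T1 (iter j3 u123) (iter k3 u23 (iter k2 x3 f)) b4.
apply: eq_bigr => -[[i4 j4] k4] _ /=.
have -> : iter k4 x2 (iter k3 u23 (iter k2 x3 f)) =
    t ^- (k3 * k4) *: iter k3 u23 (iter k4 x2 (iter k2 x3 f)).
  rewrite (iter_qcomm _ _ _ (triple_ux q0 T4)) scalerA mulVf ?scale1r//.
  by rewrite expf_neq0.
by rewrite !linearZ/= scalerA mulrCA.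
Qed.

End Words.

(** * Root vectors of type A3 as q-commutators *)

Section QCommutator.
Variables (F : fieldType) (T : Type).
Local Notation V := (T -> F^o).

(* With c = t / (t - 1), qcomm c (t - 1)^-1 x y and qcomm c c x y below are the
   only possible z and u for which (x, z, u, y) is a triple. *)
Definition qcomm (c d : F) (x y : {linear V -> V}) (f : V) : V :=
  c *: x (y f) - d *: y (x f).

Lemma qcomm_linear c d x y : linear (qcomm c d x y).
Proof.
move=> a f g; rewrite /qcomm !linearP/=; apply/funext => p.
by rewrite !fctE /GRing.scale/=; ring.
Qed.

HB.instance Definition _ c d x y :=
  GRing.isLinear.Build F V V _ (qcomm c d x y) (qcomm_linear c d x y).
End QCommutator.

(* Unlike linearB and the like, these can be instantiated with a given map, so
   that rewriting does not also push scalings and other linear functions. *)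
Lemma endoB (F : fieldType) (V : lmodType F) (x : {linear V -> V}) f g :
  x (f - g) = x f - x g.
Proof. exact: linearB. Qed.
Lemma endoD (F : fieldType) (V : lmodType F) (x : {linear V -> V}) f g :
  x (f + g) = x f + x g.
Proof. exact: linearD. Qed.
Lemma endoZ (F : fieldType) (V : lmodType F) (x : {linear V -> V}) c f :
  x (c *: f) = c *: x f.
Proof. exact: linearZ. Qed.
Definition endoE F V x := (@endoB F V x, @endoD F V x, @endoZ F V x).

(** Reduces an operator identity to a scalar one between values of words in the generators, within
    reach of [field]. *)
Ltac expand_words maps :=
  rewrite /qcomm/= /qcomm; rewrite ?maps;
  apply/funext => p; rewrite ?fctE /GRing.scale/=.

Section RankThree.
Variables (F : fieldType) (q : F) (T : Type).
Local Notation V := (T -> F^o).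
Hypothesis q0 : q != 0.
Hypothesis q1 : forall k : nat, (0 < k)%N -> q ^+ k != 1.
Local Notation t := (q ^+ 2).
Local Notation lower := (qcomm (t / (t - 1)) (t - 1)^-1).
Local Notation upper := (qcomm (t / (t - 1)) (t / (t - 1))).

Let t_neq0 : t != 0. Proof. by rewrite expf_neq0. Qed.
Let t1_neq0 : t - 1 != 0. Proof. by rewrite subr_eq0 q1. Qed.
Let tD1_neq0 : 1 + t != 0.
Proof.
apply: contraNneq (@q1 4 isT) => h; rewrite -subr_eq0.
have -> : q ^+ 4 - 1 = (1 + t) * (t - 1) by ring.
by rewrite h mul0r.
Qed.

Lemma triple_qcomm (x y : {linear V -> V}) :
  (forall f, lower x y (x f) = x (lower x y f)) ->
  (forall f, lower x y (y f) = y (lower x y f)) ->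
  triple q x (lower x y) (upper x y) y.
Proof.
by move=> hx hy; split=> // f; expand_words (endoE x, endoE y); field;
  rewrite t1_neq0 ?q0.
Qed.

Lemma qcomm_comm c d (x y w : {linear V -> V}) :
  (forall f, x (w f) = w (x f)) -> (forall f, y (w f) = w (y f)) ->
  forall f, qcomm c d x y (w f) = w (qcomm c d x y f).
Proof.
by move=> xw yw f; rewrite /qcomm linearB/= !linearZ/= yw !xw yw.
Qed.

Lemma comm_qcomm c d (x y w : {linear V -> V}) :
  (forall f, w (x f) = x (w f)) -> (forall f, w (y f) = y (w f)) ->
  forall f, w (qcomm c d x y f) = qcomm c d x y (w f).
Proof. by move=> wx wy f; rewrite (@qcomm_comm _ _ x y w). Qed.

(** A Jacobi-type identity: as [w] commutes with [y], [w u - t u w] for [u = upper x y] is [t] times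
    the commutator of [y] and [lower x w]. *)
Lemma upper_lower_qcomm (x y w : {linear V -> V}) :
  (forall f, w (y f) = y (w f)) ->
  (forall f, lower x w (y f) = y (lower x w f)) ->
  forall f, w (upper x y f) = t *: upper x y (w f).
Proof.
move=> wy lxwy f; apply/eqP; rewrite -subr_eq0; apply/eqP.
transitivity (t *: (y (lower x w f) - lower x w (y f))); last first.
  by rewrite lxwy subrr scaler0.
by expand_words (endoE x, endoE y, endoE w); rewrite !wy; field; rewrite t1_neq0.
Qed.

Lemma lower_upper_qcomm (x y w : {linear V -> V}) :
  (forall f, w (x f) = x (w f)) ->
  (forall f, lower w y (x f) = x (lower w y f)) ->
  forall f, upper x y (w f) = t *: w (upper x y f).
Proof.
move=> wx lwyx f; apply/eqP; rewrite -subr_eq0; apply/eqP.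
transitivity (t *: (lower w y (x f) - x (lower w y f))); last first.
  by rewrite lwyx subrr scaler0.
by expand_words (endoE x, endoE y, endoE w); rewrite !wx; field; rewrite t1_neq0.
Qed.

Variables x1 x2 x3 : {linear V -> V}.
Hypothesis c13 : forall f, x1 (x3 f) = x3 (x1 f).
Let linE := (endoE x1, endoE x2, endoE x3).
Local Notation z12 := (lower x1 x2).
Local Notation z23 := (lower x2 x3).
Local Notation u12 := (upper x1 x2).
Local Notation u23 := (upper x2 x3).
(** Cleared of denominators this reads [(1 + t) x1 x2 x1 = x2 x1 x1 + t x1 x1 x2]: the four
    hypotheses are the q-Serre relations of the twist. *)
Hypothesis z12_x1 : forall f, z12 (x1 f) = x1 (z12 f).
Hypothesis z12_x2 : forall f, z12 (x2 f) = x2 (z12 f).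
Hypothesis z23_x2 : forall f, z23 (x2 f) = x2 (z23 f).
Hypothesis z23_x3 : forall f, z23 (x3 f) = x3 (z23 f).

(* Root vectors of the highest root; each one belongs to two triples, which is
   what the next four identities express. *)
Local Notation z123 := (lower x1 z23).
Local Notation u1_23 := (upper x1 z23).
Local Notation u12_3 := (upper z12 x3).
Local Notation u123 := (upper u12 x3).

Lemma lower_z12_x3 f : lower z12 x3 f = z123 f.
Proof. expand_words linE; rewrite !c13; by field; rewrite t1_neq0 ?q0. Qed.
Lemma lower_u12_x3 f : lower u12 x3 f = u1_23 f.
Proof. expand_words linE; rewrite !c13; by field; rewrite t1_neq0 ?q0. Qed.
Lemma lower_x1_u23 f : lower x1 u23 f = u12_3 f.
Proof. expand_words linE; rewrite !c13; by field; rewrite t1_neq0 ?q0. Qed.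
Lemma upper_x1_u23 f : upper x1 u23 f = u123 f.
Proof. expand_words linE; rewrite !c13; by field; rewrite t1_neq0 ?q0. Qed.

(** Both entries of [lower z12 x3] commute with [x1]; for [x3] the expression [lower x1 z23] serves
    in the same way. *)
Lemma z123_x1 f : z123 (x1 f) = x1 (z123 f).
Proof. by rewrite -!lower_z12_x3 (qcomm_comm _ _ z12_x1)// => g; rewrite c13. Qed.
Lemma z123_x3 f : z123 (x3 f) = x3 (z123 f).
Proof. by rewrite (qcomm_comm _ _ c13 z23_x3). Qed.
(** Neither expression for [z123] has both entries known to commute with [x2], so the Serre
    relations themselves are combined; [S] and [P] are these relations solved for one monomial. *)
Lemma z123_x2 f : z123 (x2 f) = x2 (z123 f).
Proof.
have S g : x2 (x2 (x1 g)) = (1 + t) *: x2 (x1 (x2 g)) - t *: x1 (x2 (x2 g)).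
  apply/eqP; rewrite -subr_eq0; apply/eqP.
  transitivity ((t - 1) *: (z12 (x2 g) - x2 (z12 g))); last first.
    by rewrite z12_x2 subrr scaler0.
  by expand_words linE; field; rewrite t1_neq0.
have P g : x3 (x2 (x2 g)) = (1 + t) *: x2 (x3 (x2 g)) - t *: x2 (x2 (x3 g)).
  apply/eqP; rewrite -subr_eq0; apply/eqP.
  transitivity ((t - 1) *: (x2 (z23 g) - z23 (x2 g))); last first.
    by rewrite z23_x2 subrr scaler0.
  by expand_words linE; field; rewrite t1_neq0.
apply/eqP; rewrite -subr_eq0 -(inj_eq (scalerI tD1_neq0)) scaler0.
(* (1 + t) [z123, x2] is a combination of products of the Serre relations dS of
   (x1, x2) and dP of (x2, x3) with x3 and x1. *)
pose dS g := x2 (x2 (x1 g)) - ((1 + t) *: x2 (x1 (x2 g)) - t *: x1 (x2 (x2 g))).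
pose dP g := x3 (x2 (x2 g)) - ((1 + t) *: x2 (x3 (x2 g)) - t *: x2 (x2 (x3 g))).
apply/eqP; transitivity (((t - 1)^-1 * (t - 1)^-1) *:
    (t ^+ 2 *: dS (x3 f) - t ^+ 2 *: x1 (dP f) + dP (x1 f) - x3 (dS f))).
  by rewrite /dS /dP; expand_words linE; rewrite ?c13; field; rewrite t1_neq0.
by rewrite /dS /dP -!S -!P !subrr ?(linear0, oppr0, addr0, scaler0).
Qed.

Lemma z23_u12 f : z23 (u12 f) = t *: u12 (z23 f).
Proof. exact: upper_lower_qcomm z23_x2 z123_x2 f. Qed.

Lemma u23_z12 f : u23 (z12 f) = t *: z12 (u23 f).
Proof.
apply: (lower_upper_qcomm z12_x2) => g.
by rewrite !lower_z12_x3 z123_x2.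
Qed.

Lemma triple_1 : triple q x1 z12 u12 x2.
Proof. exact: triple_qcomm. Qed.

Lemma triple_2 : triple q x1 z123 u1_23 z23.
Proof.
apply: triple_qcomm; first exact: z123_x1.
exact: (comm_qcomm _ _ z123_x2 z123_x3).
Qed.

Lemma z123_u12 f : z123 (u12 f) = u12 (z123 f).
Proof.
exact: (comm_qcomm _ _ z123_x1 z123_x2).
Qed.

Lemma z123_z12 f : z123 (z12 f) = z12 (z123 f).
Proof.
exact: (comm_qcomm _ _ z123_x1 z123_x2).
Qed.

Lemma z123_u23 f : z123 (u23 f) = u23 (z123 f).
Proof.
exact: (comm_qcomm _ _ z123_x2 z123_x3).
Qed.

Lemma triple_4 : triple q x2 z23 u23 x3.
Proof. exact: triple_qcomm. Qed.

Lemma u1_23E f : u1_23 f = z123 f - z23 (x1 f).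
Proof. by have [_ -> _ _] := triple_2; rewrite subKr. Qed.

Lemma triple_3 : triple q u12 u1_23 u123 x3.
Proof.
(* In [u1_23 = z123 - z23 x1], moving [u12] past [x1] and past [z23] costs inverse powers of [t]. *)
have u1_23_u12 f : u1_23 (u12 f) = u12 (u1_23 f).
  rewrite !u1_23E (linearB u12)/= z123_u12; congr (_ - _).
  have h : u12 (x1 f) = t *: x1 (u12 f) := triple_ux q0 triple_1 f.
  apply: (scalerI t_neq0).
  have -> : t *: z23 (x1 (u12 f)) = z23 (t *: x1 (u12 f)) by rewrite linearZ.
  by rewrite -h z23_u12.
have [h1 h2 h3 h4] : triple q u12 (lower u12 x3) u123 x3.
  apply: triple_qcomm => f; rewrite !lower_u12_x3.
    exact: u1_23_u12.
  exact: (qcomm_comm _ _ c13 z23_x3).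
by split=> f; rewrite -?lower_u12_x3.
Qed.

Lemma triple_5 : triple q z12 z123 u12_3 x3.
Proof.
have [h1 h2 h3 h4] : triple q z12 (lower z12 x3) u12_3 x3.
  by apply: triple_qcomm => f; rewrite !lower_z12_x3 ?z123_z12 ?z123_x3.
by split=> f; rewrite -?lower_z12_x3.
Qed.

Lemma u12_3E f : u12_3 f = z123 f - x3 (z12 f).
Proof. by have [_ -> _ _] := triple_5; rewrite subKr. Qed.

Lemma triple_6 : triple q x1 u12_3 u123 u23.
Proof.
(* In [u12_3 = z123 - x3 z12], the powers of [t] from moving [u23] past [z12] and [x3] cancel. *)
have u12_3_u23 f : u12_3 (u23 f) = u23 (u12_3 f).
  rewrite !u12_3E (linearB u23)/= z123_u23; congr (_ - _).
  have h g : x3 (u23 g) = t *: u23 (x3 g) := triple_yu q0 triple_4 g.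
  apply: (scalerI t_neq0).
  have -> : t *: u23 (x3 (z12 f)) = x3 (u23 (z12 f)) by rewrite h.
  by rewrite u23_z12 linearZ.
have [h1 h2 h3 h4] : triple q x1 (lower x1 u23) (upper x1 u23) u23.
  apply: triple_qcomm => f; rewrite !lower_x1_u23.
    by apply: (qcomm_comm _ _ z12_x1) => g; rewrite c13.
  exact: u12_3_u23.
by split=> f; rewrite -?lower_x1_u23 -?upper_x1_u23.
Qed.

(** Since [x2 u12 = t u12 x2], the commutator of [x2] with [u123] becomes [t u12 z23 - z23 u12],
    which vanishes by [z23_u12]. *)
Lemma u123_x2 f : x2 (u123 f) = u123 (x2 f).
Proof.
have upper_comm (w : {linear V -> V}) :
    (forall g, w (x2 g) = t^-1 *: x2 (w g)) -> z23 (w f) = t *: w (z23 f) ->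
    x2 (upper w x3 f) = upper w x3 (x2 f).
  move=> wx2 wz; apply/eqP; rewrite -subr_eq0; apply/eqP.
  transitivity (t *: w (z23 f) - z23 (w f)); last by rewrite wz subrr.
  rewrite /qcomm/= /qcomm ?(endoE w, endoE x2, endoE x3) !wx2.
  rewrite ?(endoE w, endoE x2, endoE x3).
  apply/funext => p; rewrite ?fctE /GRing.scale/=.
  by field; rewrite t1_neq0 q0.
apply: upper_comm; last exact: z23_u12.
move=> g; have /= -> := triple_yu q0 triple_1 g.
by rewrite scalerA mulVf// scale1r.
Qed.

Lemma initial_word_two_ways n1 n2 n3 n4 n5 n6 B f :
  (10 * (n1 + n2 + n3 + n4 + n5 + n6) < B)%N ->
  lhs_words q x1 x2 x3 u12 u23 u123 n1 n2 n3 n4 n5 n6 B f =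
  rhs_words q x1 x2 x3 u12 u23 u123 n1 n2 n3 n4 n5 n6 B f.
Proof.
move=> nB.
rewrite -(initial_word_lhs q0 q1 triple_1 triple_2 triple_3 triple_4 c13
  z123_x2 z23_u12 nB f).
exact: (initial_word_rhs q0 q1 triple_1 triple_4 triple_5 triple_6 c13
  u23_z12 u123_x2 nB f).
Qed.

End RankThree.

(** * An action with linearly independent PBW monomials *)

Section Realization.
Variables (F : fieldType) (q : F).
Local Notation t := (q ^+ 2).
Local Notation V := (nat * nat * nat * nat * nat * nat -> F^o).
Hypothesis q0 : q != 0.
Hypothesis q1 : forall k : nat, (0 < k)%N -> q ^+ k != 1.
Local Notation lower := (qcomm (t / (t - 1)) (t - 1)^-1).
Local Notation upper := (qcomm (t / (t - 1)) (t / (t - 1))).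

Let t1_neq0 : t - 1 != 0. Proof. by rewrite subr_eq0 q1. Qed.

(* Transposes of the right multiplications by the simple root vectors in the
   PBW basis 1^a u12^b u123^c 2^d u23^e 3^g.  Where a predecessor is junk, its
   coefficient vanishes. *)
Definition rmul1 (f : V) : V := fun '(a, b, c, d, e, g) =>
  (1 - t ^+ e) / t * f (a, b, c.+1, d, e.-1, g)
  + t ^+ c * (1 - t ^+ d) / t * f (a, b.+1, c, d.-1, e, g)
  + t ^+ (b + c) * f (a.+1, b, c, d, e, g).
Definition rmul2 (f : V) : V := fun '(a, b, c, d, e, g) =>
  t ^+ e * f (a, b, c, d.+1, e, g)
  + (1 - t ^+ g) / t * f (a, b, c, d, e.+1, g.-1).
Definition rmul3 (f : V) : V := fun '(a, b, c, d, e, g) => f (a, b, c, d, e, g.+1).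

Lemma rmul1_linear : linear rmul1.
Proof.
move=> k f h; apply/funext => -[[[[[a b] c] d] e] g].
by rewrite /rmul1 !fctE /GRing.scale/=; ring.
Qed.
Lemma rmul2_linear : linear rmul2.
Proof.
move=> k f h; apply/funext => -[[[[[a b] c] d] e] g].
by rewrite /rmul2 !fctE /GRing.scale/=; ring.
Qed.
Lemma rmul3_linear : linear rmul3.
Proof. by move=> k f h; apply/funext => -[[[[[a b] c] d] e] g]. Qed.
HB.instance Definition _ := GRing.isLinear.Build F V V _ rmul1 rmul1_linear.
HB.instance Definition _ := GRing.isLinear.Build F V V _ rmul2 rmul2_linear.
HB.instance Definition _ := GRing.isLinear.Build F V V _ rmul3 rmul3_linear.

Lemma rmul13 f : rmul1 (rmul3 f) = rmul3 (rmul1 f).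
Proof. by apply/funext => -[[[[[a b] c] d] e] g]. Qed.

Ltac pointwise :=
  apply/funext => -[[[[[a b] c] d] e] g]; rewrite /qcomm ?fctE /GRing.scale/=.

Lemma lower_rmul23E f : lower rmul2 rmul3 f = fun '(a, b, c, d, e, g) =>
  t ^+ e * f (a, b, c, d.+1, e, g.+1) + t^-1 * f (a, b, c, d, e.+1, g).
Proof.
(* At [g = 0] the junk predecessor meets the coefficient [1 - t^0]; otherwise [g.-1] becomes
   explicit. *)
by pointwise; case: g => [|g] /=; rewrite ?(exprS t) ?expr0; field;
  rewrite t1_neq0 q0.
Qed.

Lemma lower_rmul23_rmul2 f : lower rmul2 rmul3 (rmul2 f) = rmul2 (lower rmul2 rmul3 f).
Proof.
rewrite !lower_rmul23E; pointwise.
by case: g => [|g] /=; rewrite ?(exprS t) ?expr0; field; rewrite q0.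
Qed.

Lemma lower_rmul23_rmul3 f : lower rmul2 rmul3 (rmul3 f) = rmul3 (lower rmul2 rmul3 f).
Proof. by rewrite !lower_rmul23E; pointwise. Qed.

Lemma lower_rmul12E f : lower rmul1 rmul2 f = fun '(a, b, c, d, e, g) =>
  t ^+ (e + c) / t * f (a, b.+1, c, d, e, g)
  + t ^+ (e + b + c) * f (a.+1, b, c, d.+1, e, g)
  + (1 - t ^+ g) / t ^+ 2 * f (a, b, c.+1, d, e, g.-1)
  + (1 - t ^+ g) * t ^+ c * (1 - t ^+ d) / t ^+ 2 * f (a, b.+1, c, d.-1, e.+1, g.-1)
  + (1 - t ^+ g) * t ^+ (b + c) / t * f (a.+1, b, c, d, e.+1, g.-1).
Proof.
pointwise; rewrite !(exprD t).
case: g => [|g] /=; case: d => [|d] /=; case: e => [|e] /=;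
  rewrite ?(exprS t) ?expr0;
  by field; rewrite t1_neq0 q0.
Qed.

Lemma lower_rmul12_rmul2 f : lower rmul1 rmul2 (rmul2 f) = rmul2 (lower rmul1 rmul2 f).
Proof.
rewrite !lower_rmul12E; pointwise; rewrite !(exprD t).
(* Each of the two factors can lower [g], hence the double split. *)
case: g => [|[|g]] /=; case: d => [|d] /=;
  rewrite ?(exprS t) ?expr0;
  by field; rewrite ?t1_neq0 q0.
Qed.

Lemma lower_rmul12_rmul1 f : lower rmul1 rmul2 (rmul1 f) = rmul1 (lower rmul1 rmul2 f).
Proof.
rewrite !lower_rmul12E; pointwise; rewrite !(exprD t).
case: g => [|g] /=; case: d => [|[|d]] /=; case: e => [|e] /=;
  rewrite ?(exprS t) ?expr0;
  by field; rewrite ?t1_neq0 q0.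
Qed.

Lemma iter_eval T (x : (T -> F^o) -> (T -> F^o)) (pt : nat -> T) (k : F) m f :
  (forall h i, x h (pt i) = k * h (pt i.+1)) ->
  iter m x f (pt 0%N) = k ^+ m * f (pt m).
Proof.
move=> xpt; suff h i : iter m x f (pt i) = k ^+ m * f (pt (m + i)%N) by rewrite h addn0.
elim: m i => [|m IH] i; first by rewrite mul1r.
by rewrite iterS xpt IH addnS exprS mulrA.
Qed.

(** The origin stands for the unit monomial, and a final word is a power of [t] times a single PBW
    monomial. From the origin, each letter moves along one coordinate axis with a constant
    scalar. *)
Lemma final_word_eval n1 n2 n3 n4 n5 n6 f :
  iter n4 (upper (upper rmul1 rmul2) rmul3) (iter n2 (upper rmul1 rmul2) (iter n1 rmul1
    (iter n5 (upper rmul2 rmul3) (iter n3 rmul2 (iter n6 rmul3 f)))))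
    (0%N, 0%N, 0%N, 0%N, 0%N, 0%N) =
  t ^+ (n4 * n2 + (n2 + n4) * n1 + n5 * n3) * f (n1, n2, n4, n3, n5, n6).
Proof.
rewrite (@iter_eval _ _ (fun c => (0, 0, c, 0, 0, 0)%N) 1); last first.
  move=> h c; do 2!rewrite /qcomm ?fctE /GRing.scale/=.
  by rewrite ?(exprS t) ?expr0; field; rewrite t1_neq0 q0.
rewrite (@iter_eval _ _ (fun b => (0, b, n4, 0, 0, 0)%N) (t ^+ n4)); last first.
  move=> h b; rewrite /qcomm ?fctE /GRing.scale/= ?(exprD t).
  by rewrite ?(exprS t) ?expr0; field; rewrite t1_neq0 q0.
rewrite (@iter_eval _ _ (fun a => (a, n2, n4, 0, 0, 0)%N) (t ^+ (n2 + n4))); last first.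
  by move=> h a /=; rewrite expr0; ring.
rewrite (@iter_eval _ _ (fun e => (n1, n2, n4, 0, e, 0)%N) 1); last first.
  move=> h e; rewrite /qcomm ?fctE /GRing.scale/=.
  by rewrite ?(exprS t) ?expr0; field; rewrite t1_neq0 q0.
rewrite (@iter_eval _ _ (fun d => (n1, n2, n4, d, n5, 0)%N) (t ^+ n5)); last first.
  by move=> h d /=; rewrite expr0; ring.
rewrite (@iter_eval _ _ (fun g => (n1, n2, n4, n3, n5, g)%N) 1); last first.
  by move=> h g /=; rewrite mul1r.
by rewrite !expr1n !mul1r !mulrA -!(exprM t) -!(exprD t).
Qed.

End Realization.

(** * The tetrahedron equation *)

(** Each path sums over twelve indices, six of which are fixed by the final word: [h] inserts these,
    [h'] forgets them and [C] tests for them. *)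
Lemma big_section (R : nmodType) (P S : finType) (h : S -> P) (h' : P -> S)
    (C : pred P) (E : P -> R) :
  cancel h h' -> (forall s, C (h s)) -> (forall p, C p -> h (h' p) = p) ->
  (forall p, ~~ C p -> E p = 0) -> \sum_p E p = \sum_s E (h s).
Proof.
move=> hK Ch h'K E0; rewrite (bigID C)/= [X in _ + X]big1// addr0.
rewrite (reindex_onto h h')//; apply: eq_bigl => s.
by rewrite Ch hK eqxx.
Qed.

Section Tetrahedron.
Variables (F : fieldType) (q : F).
Hypothesis q0 : q != 0.
Hypothesis q1 : forall k : nat, (0 < k)%N -> q ^+ k != 1.
Local Notation t := (q ^+ 2).
Local Notation cw := (core_weight q).
Local Notation upper := (qcomm (t / (t - 1)) (t / (t - 1))).
Variables (n1 n2 n3 n4 n5 n6 : nat) (n1'' n2'' n3'' n4'' n5'' n6'' : nat).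

Definition lhs_term (n' : nat * nat * nat * nat * nat * nat) : F :=
  let: (n1', n2', n3', n4', n5', n6') := n' in
  t ^+ (n5 * n2') * cw n1 n2 n3 n1' n2' n3' * cw n1' n4 n5 n1'' n4' n5'
  * cw n2' n4' n6 n2'' n4'' n6' * cw n3' n5' n6' n3'' n5'' n6''.

Definition rhs_term (n' : nat * nat * nat * nat * nat * nat) : F :=
  let: (n1', n2', n3', n4', n5', n6') := n' in
  t ^+ (n5' * n3') * cw n3 n5 n6 n3' n5' n6' * cw n2 n4 n6' n2' n4' n6''
  * (t ^+ (n5'' * n2') * cw n1 n4' n5' n1' n4'' n5'')
  * (t ^- (n5'' * n3'') * cw n1' n2' n3' n1'' n2'' n3'').

(** The first summand bounds the indices along both paths; the second makes the outer indices [n'']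
    elements of ['I_B]. *)
Let B := (10 * (n1 + n2 + n3 + n4 + n5 + n6) +
  (n1'' + n2'' + n3'' + n4'' + n5'' + n6'')).+1.
Local Notation I := 'I_B.
Local Notation I6 := (I * I * I * I * I * I)%type.
Let vals (s : I6) : nat * nat * nat * nat * nat * nat :=
  let: (s1, s2, s3, s4, s5, s6) := s in
  (s1 : nat, s2 : nat, s3 : nat, s4 : nat, s5 : nat, s6 : nat).

Let vals_inj : injective vals.
Proof.
move=> [[[[[a b] c] d] e] g] [[[[[a' b'] c'] d'] e'] g'] [] *.
by congr (_, _, _, _, _, _); apply: val_inj.
Qed.

Let vals_onto a b c d e g :
  [&& a < B, b < B, c < B, d < B, e < B & g < B]%N ->
  exists s, (a, b, c, d, e, g) = vals s.
Proof.
case/and5P => aB bB cB dB /andP[eB gB].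
by exists (Ordinal aB, Ordinal bB, Ordinal cB, Ordinal dB, Ordinal eB, Ordinal gB).
Qed.

Lemma fsum_lhs_term :
  \sum_(n' \in [set: nat * nat * nat * nat * nat * nat]) lhs_term n' =
  \sum_s lhs_term (vals s).
Proof.
apply: fsbig_inj vals_inj _ => -[[[[[a b] c] d] e] g].
move=> /mulf_neq0W[/mulf_neq0W[/mulf_neq0W[/mulf_neq0W[_]]]].
move=> /core_weight_conserved[h1 h2] /core_weight_conserved[h3 h4].
move=> /core_weight_conserved[h5 h6] /core_weight_conserved[h7 h8].
apply: vals_onto; apply/and5P; split; last (apply/andP; split); rewrite /B; lia.
Qed.

Lemma fsum_rhs_term :
  \sum_(n' \in [set: nat * nat * nat * nat * nat * nat]) rhs_term n' =
  \sum_s rhs_term (vals s).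
Proof.
apply: fsbig_inj vals_inj _ => -[[[[[a b] c] d] e] g].
move=> /mulf_neq0W[/mulf_neq0W[/mulf_neq0W[/mulf_neq0W[_]]]].
move=> /core_weight_conserved[h1 h2] /core_weight_conserved[h3 h4].
move=> /mulf_neq0W[_ /core_weight_conserved[h5 h6]].
move=> /mulf_neq0W[_ /core_weight_conserved[h7 h8]].
apply: vals_onto; apply/and5P; split; last (apply/andP; split); rewrite /B; lia.
Qed.

Let K : F := t ^+ (n4'' * n2'' + (n2'' + n4'') * n1'' + n5'' * n3'').
Let N1B : (n1'' < B)%N. Proof. by rewrite /B; lia. Qed.
Let N2B : (n2'' < B)%N. Proof. by rewrite /B; lia. Qed.
Let N3B : (n3'' < B)%N. Proof. by rewrite /B; lia. Qed.
Let N4B : (n4'' < B)%N. Proof. by rewrite /B; lia. Qed.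
Let N5B : (n5'' < B)%N. Proof. by rewrite /B; lia. Qed.
Let N6B : (n6'' < B)%N. Proof. by rewrite /B; lia. Qed.

Lemma core_tetrahedron :
  \sum_(n' \in [set: nat * nat * nat * nat * nat * nat]) lhs_term n' =
  \sum_(n' \in [set: nat * nat * nat * nat * nat * nat]) rhs_term n'.
Proof.
rewrite fsum_lhs_term fsum_rhs_term.
(* Applied to this delta function and evaluated at the origin, a final word gives [K] or 0, so one
   coefficient is extracted. The place of [n4''] before [n3''] follows the coordinates of the PBW
   basis. *)
pose f : nat * nat * nat * nat * nat * nat -> F^o :=
  fun p => (p == (n1'', n2'', n4'', n3'', n5'', n6''))%:R.
have nB : (10 * (n1 + n2 + n3 + n4 + n5 + n6) < B)%N by rewrite /B; lia.
have := initial_word_two_ways q0 q1 (rmul13 q)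
  (lower_rmul12_rmul1 q0 q1) (lower_rmul12_rmul2 q0 q1)
  (lower_rmul23_rmul2 q0 q1) (lower_rmul23_rmul3 q0 q1) f nB.
move=> /(congr1 (fun g => g (0, 0, 0, 0, 0, 0)%N)); rewrite /lhs_words /rhs_words.
have fwE m1 m2 m3 m4 m5 m6 : final_word (rmul1 q) (rmul2 q) (@rmul3 F)
    (upper (rmul1 q) (rmul2 q)) (upper (rmul2 q) (@rmul3 F))
    (upper (upper (rmul1 q) (rmul2 q)) (@rmul3 F))
    m1 m2 m3 m4 m5 m6 f
    (0, 0, 0, 0, 0, 0)%N =
    K * ((m1, m2, m4, m3, m5, m6) == (n1'', n2'', n4'', n3'', n5'', n6''))%:R.
  rewrite /final_word (final_word_eval q0 q1) /f /K.
  by case: eqP => [[-> -> -> -> -> _]|_]; rewrite ?mulr0.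
rewrite !pair_big !fct_sumE /=.
pose o1 := Ordinal N1B; pose o2 := Ordinal N2B; pose o3 := Ordinal N3B.
pose o4 := Ordinal N4B; pose o5 := Ordinal N5B; pose o6 := Ordinal N6B.
rewrite (big_section (h := fun '((s1, s2, s3, s4, s5, s6) : I6) =>
           (s1, s2, s3, (o1, s4, s5), (o2, o4, s6), (o3, o5, o6)))
         (h' := fun p => (p.1.1.1.1.1, p.1.1.1.1.2, p.1.1.1.2,
                          p.1.1.2.1.2, p.1.1.2.2, p.1.2.2))
         (C := fun p => (p.1.1.2.1.1, p.1.2.1.1, p.1.2.1.2, p.2.1.1, p.2.1.2, p.2.2)
                        == (o1, o2, o4, o3, o5, o6))); first last.
- move=> p nC; rewrite !fctE fwE.
  case: eqP => [[? ? ? ? ? ?]|_]; last by rewrite mulr0 scaler0.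
  by case/eqP: nC; congr (_, _, _, _, _, _); apply: val_inj.
- by move=> [[[[[a b] c] [[d e] g]] [[h i] j]] [[k l] m]] /= /eqP[-> -> -> -> -> ->].
- by move=> [[[[[a b] c] d] e] g] /=.
- by move=> [[[[[a b] c] d] e] g] /=.
rewrite [RHS](big_section (h := fun '((s1, s2, s3, s4, s5, s6) : I6) =>
           ((s3, s5, s6), (s2, s4, o6), (s1, o4, o5), (o1, o2, o3)))
         (h' := fun p => (p.1.2.1.1, p.1.1.2.1.1, p.1.1.1.1.1,
                          p.1.1.2.1.2, p.1.1.1.1.2, p.1.1.1.2))
         (C := fun p => (p.2.1.1, p.2.1.2, p.2.2, p.1.2.1.2, p.1.2.2, p.1.1.2.2)
                        == (o1, o2, o3, o4, o5, o6))); first last.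
- move=> p nC; rewrite !fctE fwE.
  case: eqP => [[? ? ? ? ? ?]|_]; last by rewrite mulr0 scaler0.
  by case/eqP: nC; congr (_, _, _, _, _, _); apply: val_inj.
- by move=> [[[[[a b] c] [[d e] g]] [[h i] j]] [[k l] m]] /= /eqP[-> -> -> -> -> ->].
- by move=> [[[[[a b] c] d] e] g] /=.
- by move=> [[[[[a b] c] d] e] g] /=.
rewrite (eq_bigr (fun s => lhs_term (vals s) * K)); last first.
  move=> [[[[[a b] c] d] e] g] _ /=; rewrite !fctE fwE eqxx mulr1.
  by rewrite /GRing.scale/=.
rewrite [RHS](eq_bigr (fun s => rhs_term (vals s) * K)); last first.
  move=> [[[[[a b] c] d] e] g] _ /=; rewrite !fctE fwE eqxx mulr1.
  by rewrite /GRing.scale/=.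
by rewrite -!big_distrl => /(mulIf _) -> //; rewrite !expf_neq0.
Qed.

End Tetrahedron.

(** * Separation of the parameters v and w *)

Section Gauge.
Variables (F : fieldType) (q : F).
Hypothesis q0 : q != 0.
Local Notation t := (q ^+ 2).
Variables (v w : F) (n1 n2 n3 n4 n5 n6 : nat) (n1'' n2'' n3'' n4'' n5'' n6'' : nat).

Lemma qpoch_add a m n : qpoch q a (m + n) = qpoch q a m * qpoch q (q ^+ (2 * m) * a) n.
Proof.
rewrite /qpoch big_split_ord/=; congr (_ * _); apply: eq_bigr => i _.
by rewrite mulnDr exprD; ring.
Qed.

(* The v- and w-dependence of both sides, up to a power of t. *)
Definition gauge : F :=
  t ^- (n2'' * n5'') * v ^+ (n4'' + n5'') * w ^+ (n2'' + n4'')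
  * (qpoch q (w * q ^- (2 * n1'')) (n3'' + n5'')
     * qpoch q (v * q ^- (2 * (n2'' + n3''))) n6''
     / (qpoch q w (n3 + n5) * qpoch q v n6)).

(** By conservation, consecutive Pochhammer symbols in [w] join into symbols of lengths [n3 + n5]
    and [n3'' + n5''], and the symbol of length [n6'] in [v] cancels between two weights. *)
Lemma lhs_gauge n1' n2' n3' n4' n5' n6' :
  (conserved n1 n2 n3 n1' n2' n3' -> conserved n1' n4 n5 n1'' n4' n5' ->
   conserved n3' n5' n6' n3'' n5'' n6'' -> conserved n2' n4' n6 n2'' n4'' n6' ->
   qpoch q (q ^- (2 * n2'') * v) n6' != 0) ->
  Sweight q (q ^+ (2 * n5) * w) n1 n2 n3 n1' n2' n3'
  * Sweight q w n1' n4 n5 n1'' n4' n5'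
  * Sweight q (q ^- (2 * n2'') * v) n3' n5' n6' n3'' n5'' n6''
  * Sweight q v n2' n4' n6 n2'' n4'' n6' =
  gauge * lhs_term q n1 n2 n3 n4 n5 n6 n1'' n2'' n3'' n4'' n5'' n6''
    (n1', n2', n3', n4', n5', n6').
Proof.
rewrite !SweightE /lhs_term.
have [h1|/core_weight_notconserved->] := boolP (conserved n1 n2 n3 n1' n2' n3');
  last by rewrite !(mul0r, mulr0).
have [h2|/core_weight_notconserved->] := boolP (conserved n1' n4 n5 n1'' n4' n5');
  last by rewrite !(mul0r, mulr0).
have [h3|/core_weight_notconserved->] := boolP (conserved n3' n5' n6' n3'' n5'' n6'');
  last by rewrite !(mul0r, mulr0).
have [h4|/core_weight_notconserved->] := boolP (conserved n2' n4' n6 n2'' n4'' n6');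
  last by rewrite !(mul0r, mulr0).
move=> /(_ isT isT isT isT) d0.
move: h1 h2 h3 h4; do 4!case/andP => /eqP ? /eqP ?.
rewrite /gauge.
have -> : (n3'' + n5'' = n5' + n3')%N by lia.
rewrite (addnC n3 n5) !qpoch_add.
have -> : (n2'' + n4'' = n2' + n4')%N by lia.
have -> : q ^+ (2 * n5) * w * q ^- (2 * n1') = q ^+ (2 * n5') * (w * q ^- (2 * n1'')).
  rewrite mulrAC [RHS]mulrA [RHS]mulrAC; congr (_ * _).
  apply: expr_div_eq => //; lia.
have -> : q ^- (2 * n2'') * v * q ^- (2 * n3'') = v * q ^- (2 * (n2'' + n3'')).
  by rewrite mulnDr exprD invfM; ring.
rewrite [v * q ^- (2 * n2'')]mulrC.
have -> : (q ^+ (2 * n5) * w) ^+ n2' = t ^+ (n5 * n2') * w ^+ n2'.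
  by rewrite exprMn -!exprM mulnA.
have -> : (q ^- (2 * n2'') * v) ^+ n5'' = t ^- (n2'' * n5'') * v ^+ n5''.
  by rewrite exprMn exprVn -!exprM mulnA.
rewrite (exprD v) (exprD w) !invfM; set P := qpoch q _ n6' in d0 *.
have PP := mulfV d0; rewrite -[RHS]mulr1 -PP.
by do ?[move: (_^-1) => ?]; ring.
Qed.

Lemma rhs_gauge n1' n2' n3' n4' n5' n6' :
  (conserved n3 n5 n6 n3' n5' n6' -> conserved n2 n4 n6' n2' n4' n6'' ->
   conserved n1 n4' n5' n1' n4'' n5'' -> conserved n1' n2' n3' n1'' n2'' n3'' ->
   qpoch q (q ^- (2 * n3') * v) n6' != 0) ->
  Sweight q v n3 n5 n6 n3' n5' n6'
  * Sweight q (q ^- (2 * n3') * v) n2 n4 n6' n2' n4' n6''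
  * Sweight q (q ^+ (2 * n3') * w) n1 n4' n5' n1' n4'' n5''
  * Sweight q w n1' n2' n3' n1'' n2'' n3'' =
  gauge * rhs_term q n1 n2 n3 n4 n5 n6 n1'' n2'' n3'' n4'' n5'' n6''
    (n1', n2', n3', n4', n5', n6').
Proof.
rewrite !SweightE /rhs_term.
have [h1|/core_weight_notconserved->] := boolP (conserved n3 n5 n6 n3' n5' n6');
  last by rewrite !(mul0r, mulr0).
have [h2|/core_weight_notconserved->] := boolP (conserved n2 n4 n6' n2' n4' n6'');
  last by rewrite !(mul0r, mulr0).
have [h3|/core_weight_notconserved->] := boolP (conserved n1 n4' n5' n1' n4'' n5'');
  last by rewrite !(mul0r, mulr0).
have [h4|/core_weight_notconserved->] := boolP (conserved n1' n2' n3' n1'' n2'' n3'');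
  last by rewrite !(mul0r, mulr0).
move=> /(_ isT isT isT isT) d0.
move: h1 h2 h3 h4; do 4!case/andP => /eqP ? /eqP ?.
rewrite /gauge.
have -> : (n3 + n5 = n3' + n5')%N by lia.
rewrite !qpoch_add.
have -> : (n4'' + n5'' = n5' + n4')%N by lia.
have -> : q ^+ (2 * n3') * w * q ^- (2 * n1') = q ^+ (2 * n3'') * (w * q ^- (2 * n1'')).
  rewrite mulrAC [RHS]mulrA [RHS]mulrAC; congr (_ * _).
  apply: expr_div_eq => //; lia.
have -> : q ^- (2 * n3') * v * q ^- (2 * n2') = v * q ^- (2 * (n2'' + n3'')).
  have -> : (2 * (n2'' + n3'') = 2 * n2' + 2 * n3')%N by lia.
  by rewrite exprD invfM; ring.
rewrite [v * q ^- (2 * n3')]mulrC.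
have -> : (q ^+ (2 * n3') * w) ^+ n4'' = t ^+ (n3' * n4'') * w ^+ n4''.
  by rewrite exprMn -!exprM mulnA.
have -> : (q ^- (2 * n3') * v) ^+ n4' = t ^- (n3' * n4') * v ^+ n4'.
  by rewrite exprMn exprVn -!exprM mulnA.
(* The exponents agree because [n4' + n5' = n4'' + n5''] and [n2' + n3' = n2'' + n3'']. *)
have E : t ^- (n3' * n4') * t ^+ (n3' * n4'') =
    t ^- (n2'' * n5'') * t ^+ (n5' * n3') * t ^+ (n5'' * n2') * t ^- (n5'' * n3'').
  have t0 k : t ^+ k != 0 by rewrite !expf_neq0.
  have h : t ^+ (n3' * n4'') * t ^+ (n2'' * n5'') * t ^+ (n5'' * n3'') =
           t ^+ (n3' * n4') * t ^+ (n5' * n3') * t ^+ (n5'' * n2').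
    rewrite -!(exprD t); congr (_ ^+ _); nia.
  transitivity (t ^+ (n3' * n4'') * t ^+ (n2'' * n5'') * t ^+ (n5'' * n3'') /
      (t ^+ (n3' * n4') * t ^+ (n2'' * n5'') * t ^+ (n5'' * n3''))).
    by field; rewrite !t0.
  by rewrite h; field; rewrite !t0.
rewrite (exprD v) (exprD w) !invfM; set P := qpoch q _ n6' in d0 *.
have PP := mulfV d0.
move: E; set A := t ^- _; set A' := t ^+ _; set B := t ^- _; set C := t ^+ _.
set D := t ^+ _; set D' := t ^- _; move=> E.
move: PP; do ?[move: (_^-1) => ?]; move=> PP.
by ring: E PP.
Qed.
End Gauge.

Lemma Sweight_tetrahedron (F : fieldType) (q v w : F) (n1 n2 n3 n4 n5 n6 : nat)
    (n1'' n2'' n3'' n4'' n5'' n6'' : nat) :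
  q != 0 -> (forall k : nat, (0 < k)%N -> q ^+ k != 1) ->
  (forall n1' n2' n3' n4' n5' n6' : nat,
     conserved n1 n2 n3 n1' n2' n3' ->
     conserved n1' n4 n5 n1'' n4' n5' ->
     conserved n3' n5' n6' n3'' n5'' n6'' ->
     conserved n2' n4' n6 n2'' n4'' n6' ->
     [&& qpoch q (q ^+ (2 * n5) * w) n3 != 0,
         qpoch q w n5 != 0,
         qpoch q (q ^- (2 * n2'') * v) n6' != 0
       & qpoch q v n6 != 0]) ->
  (forall n1' n2' n3' n4' n5' n6' : nat,
     conserved n3 n5 n6 n3' n5' n6' ->
     conserved n2 n4 n6' n2' n4' n6'' ->
     conserved n1 n4' n5' n1' n4'' n5'' ->
     conserved n1' n2' n3' n1'' n2'' n3'' ->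
     [&& qpoch q v n6 != 0,
         qpoch q (q ^- (2 * n3') * v) n6' != 0,
         qpoch q (q ^+ (2 * n3') * w) n5' != 0
       & qpoch q w n3' != 0]) ->
  \sum_(n' \in [set: nat * nat * nat * nat * nat * nat])
     (let: (n1', n2', n3', n4', n5', n6') := n' in
      Sweight q (q ^+ (2 * n5) * w) n1 n2 n3 n1' n2' n3'
      * Sweight q w n1' n4 n5 n1'' n4' n5'
      * Sweight q (q ^- (2 * n2'') * v) n3' n5' n6' n3'' n5'' n6''
      * Sweight q v n2' n4' n6 n2'' n4'' n6')
  =
  \sum_(n' \in [set: nat * nat * nat * nat * nat * nat])
     (let: (n1', n2', n3', n4', n5', n6') := n' in
      Sweight q v n3 n5 n6 n3' n5' n6'
      * Sweight q (q ^- (2 * n3') * v) n2 n4 n6' n2' n4' n6''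
      * Sweight q (q ^+ (2 * n3') * w) n1 n4' n5' n1' n4'' n5''
      * Sweight q w n1' n2' n3' n1'' n2'' n3'').
Proof.
move=> q0 q1 dl dr.
rewrite (eq_fsbigr (fun n' => gauge q v w n3 n5 n6 n1'' n2'' n3'' n4'' n5'' n6'' *
   lhs_term q n1 n2 n3 n4 n5 n6 n1'' n2'' n3'' n4'' n5'' n6'' n')); last first.
  move=> [[[[[a b] c] d] e] g] _; apply: lhs_gauge => // h1 h2 h3 h4.
  by have /and4P[] := dl _ _ _ _ _ _ h1 h2 h3 h4.
rewrite [RHS](eq_fsbigr (fun n' => gauge q v w n3 n5 n6 n1'' n2'' n3'' n4'' n5'' n6'' *
   rhs_term q n1 n2 n3 n4 n5 n6 n1'' n2'' n3'' n4'' n5'' n6'' n')); last first.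
  move=> [[[[[a b] c] d] e] g] _; apply: rhs_gauge => // h1 h2 h3 h4.
  by have /and4P[] := dr _ _ _ _ _ _ h1 h2 h3 h4.
by rewrite -!mulr_fsumr core_tetrahedron.
Qed.

Theorem theorem1p6 (R : realType) (q : R[i]) (q_neq0 : q != 0)
    (q_not_root1 : forall k : nat, (0 < k)%N -> q ^+ k != 1) :
  (forall (v : R[i]) (n1 n2 n3 : nat),
     qpoch q v n3 != 0 ->
     \sum_(n' \in [set: nat * nat * nat])
        (let: (n1', n2', n3') := n' in Sweight q v n1 n2 n3 n1' n2' n3') = 1)
  /\
  (forall (v w : R[i]) (n1 n2 n3 n4 n5 n6 : nat)
      (n1'' n2'' n3'' n4'' n5'' n6'' : nat),
     (* the denominators of the left-hand side *)
     (forall n1' n2' n3' n4' n5' n6' : nat,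
        conserved n1 n2 n3 n1' n2' n3' ->
        conserved n1' n4 n5 n1'' n4' n5' ->
        conserved n3' n5' n6' n3'' n5'' n6'' ->
        conserved n2' n4' n6 n2'' n4'' n6' ->
        [&& qpoch q (q ^+ (2 * n5) * w) n3 != 0,
            qpoch q w n5 != 0,
            qpoch q (q ^- (2 * n2'') * v) n6' != 0
          & qpoch q v n6 != 0]) ->
     (* the denominators of the right-hand side *)
     (forall n1' n2' n3' n4' n5' n6' : nat,
        conserved n3 n5 n6 n3' n5' n6' ->
        conserved n2 n4 n6' n2' n4' n6'' ->
        conserved n1 n4' n5' n1' n4'' n5'' ->
        conserved n1' n2' n3' n1'' n2'' n3'' ->
        [&& qpoch q v n6 != 0,
            qpoch q (q ^- (2 * n3') * v) n6' != 0,
            qpoch q (q ^+ (2 * n3') * w) n5' != 0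
          & qpoch q w n3' != 0]) ->
     \sum_(n' \in [set: nat * nat * nat * nat * nat * nat])
        (let: (n1', n2', n3', n4', n5', n6') := n' in
         Sweight q (q ^+ (2 * n5) * w) n1 n2 n3 n1' n2' n3'
         * Sweight q w n1' n4 n5 n1'' n4' n5'
         * Sweight q (q ^- (2 * n2'') * v) n3' n5' n6' n3'' n5'' n6''
         * Sweight q v n2' n4' n6 n2'' n4'' n6')
     =
     \sum_(n' \in [set: nat * nat * nat * nat * nat * nat])
        (let: (n1', n2', n3', n4', n5', n6') := n' in
         Sweight q v n3 n5 n6 n3' n5' n6'
         * Sweight q (q ^- (2 * n3') * v) n2 n4 n6' n2' n4' n6''
         * Sweight q (q ^+ (2 * n3') * w) n1 n4' n5' n1' n4'' n5''
         * Sweight q w n1' n2' n3' n1'' n2'' n3'')).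
Proof.
split=> *; first exact: sum_Sweight.
exact: Sweight_tetrahedron.
Qed.
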